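(* Let $1<p<\infty$, $p'=p/(p-1)$, $q,Q,t\in\mathbb{R}$, $s>-1$, with $s+t<-(N+1)$ and $Q>q$, and let $\omega$ be a weight on $\mathbb{B}$. Then $P_{s,t}$ is well defined and continuous from $L^p(\omega\,d\mu_q)$ to $L^p(\omega\,d\mu_Q)$ if and only if $$\left(\int_{\mathbb{B}}\omega(z)\,d\mu_{Q+pt}(z)\right)\left(\int_{\mathbb{B}}\omega(z)^{\frac{-1}{p-1}}\,d\mu_{q+p'(s-q)}(z)\right)^{p-1}<\infty .$$ Moreover, $$\|P_{s,t}\|^p\simeq\left(\int_{\mathbb{B}}\omega(z)\,d\mu_{Q+pt}(z)\right)\left(\int_{\mathbb{B}}\omega(z)^{\frac{-1}{p-1}}\,d\mu_{q+p'(s-q)}(z)\right)^{p-1},$$ where $\|P_{s,t}\|$ is the operator norm from $L^p(\omega\,d\mu_q)$ to $L^p(\omega\,d\mu_Q)$.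
   Context: $N\ge1$; $\langle z,w\rangle=\sum_{j=1}^N z_j\overline{w_j}$, $|z|=\sqrt{\langle z,z\rangle}$ on $\mathbb{C}^N$; $\mathbb{B}$ is the open unit ball of $\mathbb{C}^N$; $\mu$ is normalized Lebesgue measure on $\mathbb{B}$; for $c\in\mathbb{R}$, $d\mu_c(z)=(1-|z|^2)^c d\mu(z)$. A weight is a positive (a.e.) locally integrable function on $\mathbb{B}$. For $a\le-(N+1)$, $K_a(z,w)=\sum_{k\ge0}\frac{k!}{(1-N-a)_k}\langle z,w\rangle^k$ with $(u)_k=\Gamma(u+k)/\Gamma(u)$. The operator is $P_{s,t}f(z)=(1-|z|^2)^t\int_{\mathbb{B}}K_{s+t}(z,w)f(w)(1-|w|^2)^{s}\,d\mu(w)$. ''Well defined and continuous'' means that for every $f\in L^p(\omega\,d\mu_q)$ the integral converges absolutely for almost every $z\in\mathbb{B}$, and $\|P_{s,t}f\|_{L^p(\omega\,d\mu_Q)}\le C\|f\|_{L^p(\omega\,d\mu_q)}$ with $C$ independent of $f$. $A\simeq B$ means $c\,A\le B\le C\,A$ with constants $c,C>0$ independent of the weight $\omega$. *)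

(* Defs.v *)
From HB Require Import structures.
From mathcomp Require Import all_boot all_order all_algebra.
From mathcomp Require Import all_classical all_reals all_analysis.
From mathcomp Require Import complex.

Set Implicit Arguments.
Unset Strict Implicit.
Unset Printing Implicit Defensive.

Import Order.TTheory GRing.Theory Num.Theory.
Import numFieldNormedType.Exports.

Local Open Scope classical_set_scope.
Local Open Scope ring_scope.

(* R[i] with the topology given by the modulus. *)
HB.instance Definition _ (R : realType) := NormedModule.copy R[i] R[i]^o.

(* The Borel sigma-algebra of R[i], obtained from R * R. *)
Definition complex_display : measure_display.
Proof. exact: default_measure_display. Qed.

Section complex_measurable.
Variable R : realType.

Definition pair_of_complex (z : R[i]) : measurableTypeR R * measurableTypeR R :=
  (complex.Re z, complex.Im z).
Definition complex_of_pair (x : measurableTypeR R * measurableTypeR R) : R[i] :=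
  Complex x.1 x.2.

Lemma pair_of_complexK : cancel pair_of_complex complex_of_pair.
Proof. by case. Qed.
Lemma complex_of_pairK : cancel complex_of_pair pair_of_complex.
Proof. by case. Qed.

Let cms : set (set R[i]) := [set pair_of_complex @^-1` A | A in measurable].

Let cms0 : cms set0.
Proof. by exists set0 => //; rewrite preimage_set0. Qed.
Let cmsC A : cms A -> cms (~` A).
Proof.
by move=> [B mB <-]; exists (~` B); [exact: measurableC | rewrite preimage_setC].
Qed.
Let cms_bigcup (F : (set R[i])^nat) :
  (forall i, cms (F i)) -> cms (\bigcup_i F i).
Proof.
move=> cmsF; have /choice[G GF] : forall i, exists A,
    measurable A /\ pair_of_complex @^-1` A = F i.
  by move=> i; have [A mA AF] := cmsF i; exists A.
exists (\bigcup_i G i).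
  by apply: bigcupT_measurable => i; case: (GF i).
by rewrite preimage_bigcup; apply: eq_bigcupr => i _; case: (GF i).
Qed.

HB.instance Definition _ := @isMeasurable.Build complex_display R[i] cms
  cms0 cmsC cms_bigcup.

Lemma measurable_pair_of_complex : measurable_fun setT pair_of_complex.
Proof. by move=> _ A mA; rewrite setTI; exists A. Qed.

Lemma measurable_complex_of_pair : measurable_fun setT complex_of_pair.
Proof.
move=> _ _ [A mA <-]; rewrite setTI -comp_preimage.
by rewrite (_ : _ \o _ = id) //; apply/funext => -[].
Qed.

End complex_measurable.


(* The library's sigma-finite instance for products is shadowed by the one for
   products of subprobabilities, hence this lemma. *)
Lemma sigma_finite_product d1 d2 (T1 : measurableType d1)
    (T2 : measurableType d2) (R : realType)
    (m1 : {sigma_finite_measure set T1 -> \bar R})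
    (m2 : {sigma_finite_measure set T2 -> \bar R}) :
  sigma_finite setT (m1 \x m2)%E.
Proof.
have /sigma_finiteP[F [TF ndF Foo]] := sigma_finiteT m1.
have /sigma_finiteP[G [TG ndG Goo]] := sigma_finiteT m2.
exists (fun n => F n `*` G n).
  rewrite -setXTT TF TG predeqE => -[x y]; split.
    move=> [/= [n _ Fnx] [k _ Gky]]; exists (maxn n k) => //; split.
    - by move: x Fnx; exact/subsetPset/ndF/leq_maxl.
    - by move: y Gky; exact/subsetPset/ndG/leq_maxr.
  by move=> [n _ []/= ? ?]; split; exists n.
move=> k; have [? ?] := Foo k; have [? ?] := Goo k.
split; first exact: measurableX.
by rewrite product_measure1E// lte_mul_pinfty// ge0_fin_numE.
Qed.

Lemma sigma_finite_pushforward d1 d2 (T1 : measurableType d1)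
    (T2 : measurableType d2) (R : realType) (m : set T1 -> \bar R)
    (f : T1 -> T2) (g : T2 -> T1) :
  measurable_fun setT g -> cancel f g ->
  sigma_finite setT m -> sigma_finite setT (pushforward m f).
Proof.
move=> mg fK [F TF Foo]; exists (fun i => g @^-1` F i).
  by rewrite -preimage_bigcup -TF preimage_setT.
move=> i; have [mF Fi] := Foo i; split.
  by rewrite -[X in measurable X]setTI; exact: mg.
by rewrite /pushforward -comp_preimage (_ : g \o f = id)//; exact/funext.
Qed.

Section complex_lebesgue.
Context {R : realType}.

Local Notation leb := (@lebesgue_measure R).

Definition complex_lebesgue : set R[i] -> \bar R :=
  pushforward (leb \x leb)%E (@complex_of_pair R).

Let cleb0 : complex_lebesgue set0 = 0%E.
Proof. by rewrite /complex_lebesgue /pushforward preimage_set0 measure0. Qed.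
Let cleb_ge0 A : (0 <= complex_lebesgue A)%E.
Proof. by rewrite /complex_lebesgue /pushforward measure_ge0. Qed.
Let cleb_semi_sigma_additive : semi_sigma_additive complex_lebesgue.
Proof.
by apply: measure_semi_sigma_additive; exact: measurable_complex_of_pair.
Qed.
HB.instance Definition _ := isMeasure.Build _ _ _ complex_lebesgue
  cleb0 cleb_ge0 cleb_semi_sigma_additive.

Let cleb_sigma_finite : sigma_finite setT complex_lebesgue.
Proof.
exact: (sigma_finite_pushforward (@measurable_pair_of_complex R)
  (@complex_of_pairK R) (sigma_finite_product leb leb)).
Qed.
HB.instance Definition _ := Measure_isSigmaFinite.Build _ _ _ complex_lebesgue
  cleb_sigma_finite.
End complex_lebesgue.

Section tuple_measure.
Context d (T : measurableType d) (R : realType).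
Variable m : {sigma_finite_measure set T -> \bar R}.

Definition tuple_cons n (x : T * n.-tuple T) : n.+1.-tuple T :=
  [the n.+1.-tuple T of x.1 :: x.2].
Definition tuple_uncons n (x : n.+1.-tuple T) : T * n.-tuple T :=
  (thead x, [tuple of behead x]).

Lemma tuple_consK n : cancel (@tuple_cons n) (@tuple_uncons n).
Proof. by case=> x y; congr pair; exact/val_inj. Qed.

Lemma measurable_tuple_cons n : measurable_fun setT (@tuple_cons n).
Proof. exact: measurable_cons. Qed.

Lemma measurable_tuple_uncons n : measurable_fun setT (@tuple_uncons n).
Proof.
apply/measurable_fun_pairP.
by split; [exact: measurable_tnth | exact: measurable_behead].
Qed.

Section tuple_measureS.
Variables (n : nat) (mn : {sigma_finite_measure set (n.-tuple T) -> \bar R}).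

Definition tuple_measureS : set (n.+1.-tuple T) -> \bar R :=
  pushforward (m \x mn)%E (@tuple_cons n).

Let mS0 : tuple_measureS set0 = 0%E.
Proof. by rewrite /tuple_measureS /pushforward preimage_set0 measure0. Qed.
Let mS_ge0 A : (0 <= tuple_measureS A)%E.
Proof. by rewrite /tuple_measureS /pushforward measure_ge0. Qed.
Let mS_semi_sigma_additive : semi_sigma_additive tuple_measureS.
Proof.
by apply: measure_semi_sigma_additive; exact: measurable_tuple_cons.
Qed.
HB.instance Definition _ := isMeasure.Build _ _ _ tuple_measureS
  mS0 mS_ge0 mS_semi_sigma_additive.

Let mS_sigma_finite : sigma_finite setT tuple_measureS.
Proof.
exact: (sigma_finite_pushforward (@measurable_tuple_uncons n)
  (@tuple_consK n) (sigma_finite_product m mn)).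
Qed.
HB.instance Definition _ := Measure_isSigmaFinite.Build _ _ _ tuple_measureS
  mS_sigma_finite.
End tuple_measureS.

Fixpoint tuple_measure n : {sigma_finite_measure set (n.-tuple T) -> \bar R} :=
  match n with
  | 0 => \d_[tuple]
  | n'.+1 => tuple_measureS (tuple_measure n')
  end.
End tuple_measure.

Section bergman.
Context {R : realType} {N : nat}.

Notation C := (R[i]).
Notation CN := (N.-tuple C).

Definition cmod (x : C) : R := ComplexField.Normc.normc x.

Definition hdot (z w : CN) : C := \sum_(j < N) tnth z j * (tnth w j)^*%C.

Definition vnorm (z : CN) : R := Num.sqrt (complex.Re (hdot z z)).

Definition vdist (z w : CN) : R :=
  vnorm [tuple tnth z j - tnth w j | j < N].

Definition uball : set CN := [set z | vnorm z < 1].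

(* Lebesgue measure on the whole of C^N, scaled so that the unit ball has
   measure 1; it is only ever used inside the ball. *)
Definition ball_measure : {measure set CN -> \bar R} :=
  let leb := tuple_measure complex_lebesgue N in
  mscale (NngNum (eqbRL (invr_ge0 _) (fine_ge0 (measure_ge0 leb uball)))) leb.

(* dmu_c = wt c dmu, and L^p(omega dmu_c) is taken with density omega * wt c. *)
Definition wt (c : R) (z : CN) : R := (1 - vnorm z ^+ 2) `^ c.

Definition is_weight (omega : CN -> R) : Prop :=
  [/\ measurable_fun uball omega,
      {ae ball_measure, forall z, uball z -> 0 < omega z} &
      forall z, uball z -> exists2 r : R, 0 < r &
        ball_measure.-integrable (uball `&` [set w | vdist z w < r])
          (EFin \o omega)].

(* Euler's integral; converges, and is used, for u > 0 only. *)
Definition Gamma (u : R) : R :=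
  \int[lebesgue_measure]_(x in `]0, +oo[) (x `^ (u - 1) * expR (- x)).

Definition pochhammer (u : R) (k : nat) : R := Gamma (u + k%:R) / Gamma u.

(* The formula for a <= -(N+1); the kernel has another form for larger a. *)
Definition bkernel (a : R) (z w : CN) : C :=
  limn (series (fun k : nat =>
    (k`!%:R / pochhammer (1 - N%:R - a) k)%:C%C * hdot z w ^+ k)).

Definition cintegral (f : CN -> C) : C :=
  Complex (\int[ball_measure]_(w in uball) complex.Re (f w))
          (\int[ball_measure]_(w in uball) complex.Im (f w)).

Definition bop_integrand (s t : R) (f : CN -> C) (z w : CN) : C :=
  bkernel (s + t) z w * f w * (wt s w)%:C%C.

Definition bop (s t : R) (f : CN -> C) (z : CN) : C :=
  (wt t z)%:C%C * cintegral (bop_integrand s t f z).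

Definition mu_integral (c : R) (g : CN -> R) : \bar R :=
  (\int[ball_measure]_(z in uball) (g z * wt c z)%:E)%E.

Definition wnorm (p c : R) (omega : CN -> R) (f : CN -> C) : \bar R :=
  (mu_integral c (fun z => (cmod (f z) `^ p * omega z)%R) `^ p^-1)%E.

Definition in_wLp (p c : R) (omega : CN -> R) (f : CN -> C) : Prop :=
  measurable_fun uball f /\ (wnorm p c omega f < +oo)%E.

Definition bop_well_defined (p q s t : R) (omega : CN -> R) : Prop :=
  forall f : CN -> C, in_wLp p q omega f ->
    {ae ball_measure, forall z, uball z ->
      (\int[ball_measure]_(w in uball)
         (cmod (bop_integrand s t f z w))%:E < +oo)%E}.

Definition bop_bounded_by (p q Q s t : R) (omega : CN -> R) (M : R) : Prop :=
  forall f : CN -> C, in_wLp p q omega f ->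
    (wnorm p Q omega (bop s t f) <= M%:E * wnorm p q omega f)%E.

Definition bop_well_defined_continuous (p q Q s t : R) (omega : CN -> R) :
    Prop :=
  bop_well_defined p q s t omega /\
  exists M : R, bop_bounded_by p q Q s t omega M.

(* The least bound of P_{s,t}; it is +oo when P_{s,t} is not well defined and
   continuous, the set below being empty then. *)
Definition bop_norm (p q Q s t : R) (omega : CN -> R) : \bar R :=
  ereal_inf [set M%:E | M in
    [set M : R | [/\ 0 <= M, bop_well_defined p q s t omega
                   & bop_bounded_by p q Q s t omega M]]].

Definition weight_constant (p q Q s t : R) (omega : CN -> R) : \bar R :=
  let p' := p / (p - 1) in
  (mu_integral (Q + p * t) omega *
   mu_integral (q + p' * (s - q))
     (fun z => (omega z `^ (- 1 / (p - 1)))%R) `^ (p - 1))%E.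

End bergman.

(* Main.v *)
Require Import Defs.
From mathcomp Require Import all_boot all_order all_algebra.
From mathcomp Require Import all_classical all_reals all_analysis.
From mathcomp Require Import complex.
From mathcomp Require Import measurable_realfun ring lra.

Import Order.TTheory GRing.Theory Num.Theory.
Import numFieldNormedType.Exports.
Import HBNNSimple.

Local Open Scope classical_set_scope.
Local Open Scope ring_scope.

(** Put [u = 1 - N - (s + t) > 2].  The coefficients [c_k = k!/(u)_k] of the
    kernel are summable, decreasing and convex, so the kernel is bounded, and by
    Fejer's argument its real part is at least [1/2].  Hence [P_{s,t} f] is
    bounded by a constant times [(1 - |z|^2)^t * \int |f| dmu_s], and for
    [f >= 0] it is also bounded below by such a quantity.  The norm is therefore
    comparable to that of a rank-one operator: Hoelder's inequality gives the
    upper bound, and truncations of the extremal function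
    [omega^(-1/(p-1)) (1 - |z|^2)^((s-q)/(p-1))] give the lower bound. *)

(** The threshold u = 2 is that of summability: c_k decays like k^(1-u), and for u = 2 it is
    1/(k+1). Above it the kernel stays bounded even where <z,w> approaches 1, so every estimate is
    pointwise in z and w.

    The test functions are spread over the whole ball, so the lower bound needs a sign of Re K that
    does not depend on the positions of z and w; convexity of the coefficients provides it.

    The symbol (u)_k is defined by Euler's integral, so the ratio c_{k+1}/c_k = (k+1)/(u+k), on
    which all properties of c_k rest, requires the functional equation of Gamma.

    The extremal function may have infinite norm. Its truncations have norm b_n^(1/p) and integral
    b_n with b_n finite; testing gives (b_n/2)^p A <= M^p b_n, where A is the integral of omega, and
    a finite b_n > 0 can be cancelled before n grows.

    The constants 1/2 and 2 C come from Re K >= 1/2 and from |K| <= C applied to real and imaginary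
    parts; neither depends on omega. *)

(** * Euler's integral: convergence, functional equation, positivity *)

Section gamma.
Context {R : realType}.
Implicit Types (u a x : R).
Local Notation leb := (@lebesgue_measure R).

(** The remaining factor e^(-x/2) is integrable and tends to 0, so one bound serves both for limits
    and for convergence. With x = 2 a y the claim reduces to ln y <= y, whence the constant
    (2a)^a. *)
Lemma powR_expR_bounded a : 0 < a ->
  exists2 C : R, 0 < C & forall x, 0 <= x -> x `^ a * expR (- x) <= C * expR (- (x / 2)).
Proof.
move=> a0; exists ((2 * a) `^ a); first by rewrite powR_gt0 ?mulr_gt0.
move=> x; rewrite le_eqVlt => /orP[/eqP<-|x0].
  by rewrite powR0 ?gt_eqF// mul0r mulr_ge0 ?powR_ge0 ?expR_ge0.
rewrite /powR !gt_eqF ?mulr_gt0// -!expRD ler_expR.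
have [y y0 ->] : exists2 y, 0 < y & x = 2 * a * y.
  exists (x / (2 * a)); first by rewrite divr_gt0 ?mulr_gt0.
  by rewrite mulrC divfK// gt_eqF// mulr_gt0.
rewrite lnM ?posrE ?mulr_gt0//.
have -> : 2 * a * y / 2 = a * y by field.
have : a * ln y <= a * y by rewrite ler_pM2l// ltW// ln_sublinear.
by rewrite mulrDr; lra.
Qed.

Lemma cvg_expR_divn2 : expR (- (x / 2)) @[x --> +oo] --> (0 : R).
Proof.
have -> : (fun x : R => expR (- (x / 2))) =
   (fun z => expR (- z)) \o (fun z => 2^-1 * z).
  by apply/funext => x /=; rewrite mulrC.
apply: (@cvg_comp _ _ _ _ _ _ (pinfty_nbhs R)); last exact: cvgr_expR.
by apply: gt0_cvgMry => //.
Qed.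

Lemma cvg_powR_expR a : 0 < a -> x `^ a * expR (- x) @[x --> +oo] --> (0 : R).
Proof.
move=> a0; have [C C0 bC] := powR_expR_bounded a a0.
apply: (@squeeze_cvgr _ _ _ _ (cst 0) (fun x => C * expR (- (x / 2)))).
- near=> x; rewrite /= mulr_ge0 ?powR_ge0 ?expR_ge0//= bC//.
- exact: cvg_cst.
- by rewrite -(mulr0 C); apply: cvgMr; exact: cvg_expR_divn2.
Unshelve. all: by end_near. Qed.

Lemma within_continuous_powR a : 0 < a ->
  {within `[0, +oo[, continuous (fun x : R => x `^ a)}.
Proof.
move=> a0; apply/continuous_within_itvcyP; split.
  move=> x; rewrite in_itv/= andbT => x0.
  apply: differentiable_continuous; apply/derivable1_diffP.
  by apply: derivable_powR; rewrite in_itv/= x0.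
by rewrite powR0 ?gt_eqF//; exact: powR_cvg0.
Qed.

Lemma is_derive_expR_divn2 x :
  is_derive x 1 (fun y : R => expR (- (y / 2))) (- (expR (- (x / 2)) / 2)).
Proof.
have h : is_derive x 1 (fun y : R => - (y / 2)) (- 2^-1).
  have -> : (fun y : R => - (y / 2)) = (fun y : R => - 2^-1 *: (y : R^o)).
    by apply/funext => y; rewrite /GRing.scale/= mulNr mulrC.
  apply: is_derive_eq.
  by rewrite /GRing.scale/= mulr1.
have := @is_derive1_comp _ (@expR R) (fun y : R => - (y / 2)) x _ _ (is_derive_expR _) h.
by rewrite mulrC mulNr mulrC.
Qed.

Lemma is_derive_powR_expR u x : 0 < x ->
  is_derive x 1 (fun y : R => y `^ u * expR (- y))
    (u * (x `^ (u - 1) * expR (- x)) - x `^ u * expR (- x)).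
Proof.
move=> x0.
have h : is_derive x 1 (fun y : R => expR (- y)) (- expR (- x)).
  have h0 : is_derive x 1 (fun y : R => - y) (- 1) by exact: is_deriveN.
  have := @is_derive1_comp _ (@expR R) (fun y : R => - y) x _ _ (is_derive_expR _) h0.
  by rewrite mulrN1.
have h' := is_derive1_powR u x0.
apply: is_derive_eq.
by rewrite /GRing.scale/=; ring.
Qed.

Lemma measurable_powR_expR a (A : set R) :
  measurable_fun A (fun x : R => (x `^ a * expR (- x))%:E).
Proof.
apply: measurable_funTS; apply/measurable_EFinP; apply: measurable_funM => //.
by apply: measurableT_comp => //.
Qed.

Lemma measurable_expR_divn2 (C : R) (A : set R) :
  measurable_fun A (fun x : R => (C * expR (- (x / 2)))%:E).
Proof.
apply: measurable_funTS; apply/measurable_EFinP; apply: measurable_funM => //.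
by apply: measurableT_comp => //; apply: measurable_funN; apply: measurable_funM.
Qed.

Lemma integral_expR_divn2 (C : R) : 0 <= C ->
  (\int[leb]_(x in `[0%R, +oo[) (C * expR (- (x / 2)))%:E = (2 * C)%:E)%E.
Proof.
move=> C0; pose F := fun x : R => - 2 * C * expR (- (x / 2)).
have dF x : is_derive x 1 F (C * expR (- (x / 2))).
  have h := is_derive_expR_divn2 x.
  apply: is_derive_eq; rewrite /GRing.scale/=.
  by field.
have cE x : {for x, continuous (fun x : R => expR (- (x / 2)))}.
  apply: differentiable_continuous; apply/derivable1_diffP.
  by have [] := is_derive_expR_divn2 x.
rewrite (@ge0_continuous_FTC2y _ _ F 0 0).
- by rewrite /F mul0r oppr0 expR0 -EFinB; congr EFin; ring.
- by move=> x _; rewrite mulr_ge0 ?expR_ge0.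
- apply: continuous_subspaceT => x; apply: cvgM; [exact: cvg_cst|exact: cE].
- by rewrite -(mulr0 (- 2 * C)); apply: cvgMr; exact: cvg_expR_divn2.
- by move=> x _; have [] := dF x.
- by apply: cvg_at_right_filter; apply: cvgM; [exact: cvg_cst|exact: cE].
- by move=> x _; rewrite derive1E; have [_] := dF x.
Qed.

(** Integration by parts: x^u e^(-x) vanishes at 0 and at infinity, and for u > 1 the power x^(u-1)
    is continuous at 0 too. Finiteness accompanies the identity because [Gamma] takes [fine] of the
    integral and [fineM] asks for finite factors. *)
Lemma integral_powR_expRS u : 1 < u ->
  (\int[leb]_(x in `]0%R, +oo[) (x `^ u * expR (- x))%:E =
   u%:E * \int[leb]_(x in `]0%R, +oo[) (x `^ (u - 1) * expR (- x))%:E)%E /\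
  (\int[leb]_(x in `]0%R, +oo[) (x `^ (u - 1) * expR (- x))%:E < +oo)%E.
Proof.
move=> u1; have u0 : 0 < u by lra.
have u10 : 0 < u - 1 by lra.
have [C0 C00 bC0] := powR_expR_bounded _ u10.
pose C := u * C0; have C1 : 0 < C by rewrite mulr_gt0.
pose h := fun x : R => C * expR (- (x / 2)).
(* The summand [h] makes [f >= 0], as the improper fundamental theorem of
   calculus for [F] requires. *)
pose f := fun x : R => x `^ u * expR (- x) + (h x - u * (x `^ (u - 1) * expR (- x))).
pose F := fun x : R => - (x `^ u * expR (- x)) + (- 2 * C * expR (- (x / 2))).
have bC x : 0 <= x -> u * (x `^ (u - 1) * expR (- x)) <= h x.
  by move=> x0; rewrite /h /C -mulrA ler_pM2l// bC0.
have cE x : {for x, continuous (fun x : R => expR (- x))}.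
  by apply: continuous_comp; [exact: continuousN | exact: continuous_expR].
have cE2 x : {for x, continuous (fun x : R => expR (- (x / 2)))}.
  apply: differentiable_continuous; apply/derivable1_diffP.
  by have [] := is_derive_expR_divn2 x.
have cpE a : 0 < a -> {within `[0, +oo[, continuous (fun x : R => x `^ a * expR (- x))}.
  move=> a0 x; apply: cvgM; first exact: (within_continuous_powR a a0).
  by apply: continuous_subspaceT => y; exact: cE.
have dF x : 0 < x -> is_derive x 1 F (f x).
  move=> x0; have k1 := is_derive_expR_divn2 x.
  have k2 := is_derive_powR_expR u x x0.
  apply: is_derive_eq; rewrite /GRing.scale/= /f /h.
  by field.
have f0 x : 0 <= x -> 0 <= f x.
  move=> x0; rewrite addr_ge0 ?mulr_ge0 ?powR_ge0 ?expR_ge0//.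
  by rewrite subr_ge0 bC.
have If : (\int[leb]_(x in `[0%R, +oo[) (f x)%:E = (2 * C)%:E)%E.
  rewrite (@ge0_continuous_FTC2y _ _ F 0 0)//.
  - rewrite /F powR0 ?gt_eqF// !mul0r oppr0 expR0 -EFinB; congr EFin; ring.
  - move=> x; apply: cvgD; first exact: cpE.
    apply: cvgB; last by apply: cvgMr; exact: cpE.
    apply: cvgMr.
    by apply: continuous_subspaceT => y; exact: cE2.
  - rewrite -[X in _ --> X](addr0 0); apply: cvgD.
      by rewrite -oppr0; apply: cvgN; exact: cvg_powR_expR.
    by rewrite -(mulr0 (- 2 * C)); apply: cvgMr; exact: cvg_expR_divn2.
  - by move=> x x0; have [] := dF x x0.
  - apply: cvgD.
      have /continuous_within_itvcyP[_ cu] := cpE u u0.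
      by apply: cvgN.
    by apply: cvg_at_right_filter; apply: cvgMr; exact: cE2.
  - by move=> x; rewrite in_itv/= andbT => x0; rewrite derive1E; have [_] := dF x x0.
have Ih := integral_expR_divn2 C (ltW C1).
rewrite -integral_itv_obnd_cbnd in Ih; last exact: measurable_expR_divn2.
have mf : measurable_fun (`]0, +oo[ : set R) (EFin \o f).
  apply/measurable_EFinP; apply: measurable_funD.
    by apply/measurable_EFinP; exact: measurable_powR_expR.
  apply: measurable_funB.
    by apply/measurable_EFinP; exact: measurable_expR_divn2.
  apply: measurable_funM => //.
  by apply/measurable_EFinP; exact: measurable_powR_expR.
rewrite -integral_itv_obnd_cbnd// in If.
set G1 := (\int[leb]_(x in `]0%R, +oo[) (x `^ (u - 1) * expR (- x))%:E)%E.
set G2 := (\int[leb]_(x in `]0%R, +oo[) (x `^ u * expR (- x))%:E)%E.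
have mE a := measurable_powR_expR a (`]0, +oo[ : set R).
have mM : measurable_fun (`]0, +oo[ : set R)
    (fun x : R => (u%:E * (x `^ (u - 1) * expR (- x))%:E)%E).
  apply: measurable_funeM; exact: mE.
(* The integrals of [f] and [h] both equal 2 C. The identity integrates x^u e^(-x) + h = f + u
   x^(u-1) e^(-x), all of whose terms are nonnegative. *)
have E1 : (G2 + (2 * C)%:E = (2 * C)%:E + u%:E * G1)%E.
  rewrite -{1}Ih -If -ge0_integralZl//; last 2 first.
  - by move=> x _; rewrite lee_fin mulr_ge0 ?powR_ge0 ?expR_ge0.
  - by rewrite lee_fin ltW.
  rewrite -!ge0_integralD//=.
  - by apply: eq_integral => x _; rewrite /= -?EFinM -?EFinD; congr EFin; rewrite /f /h; ring.
  - by move=> x; rewrite in_itv/= andbT => /ltW x0; rewrite lee_fin f0.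
  - by move=> x _; rewrite lee_fin !mulr_ge0 ?powR_ge0 ?expR_ge0// ltW.
  - by move=> x _; rewrite lee_fin mulr_ge0 ?powR_ge0 ?expR_ge0.
  - exact: mE.
  - by move=> x _; rewrite lee_fin mulr_ge0 ?powR_ge0 ?expR_ge0// ltW.
  - exact: measurable_expR_divn2.
  - exact: mE.
have fin1 : (G1 < +oo)%E.
  have : (u%:E * G1 <= (2 * C)%:E)%E.
    rewrite -Ih -ge0_integralZl//; last 2 first.
    - by move=> x _; rewrite lee_fin mulr_ge0 ?powR_ge0 ?expR_ge0.
    - by rewrite lee_fin ltW.
    apply: ge0_le_integral => //.
    - by move=> x _; rewrite lee_fin !mulr_ge0 ?powR_ge0 ?expR_ge0// ltW.
    - exact: measurable_expR_divn2.
    - by move=> x /=; rewrite in_itv/= andbT => /ltW x0; rewrite lee_fin bC.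
    - exact: mE.
  case: G1 {E1} => // [r|]; first by rewrite ltry.
  by rewrite gt0_muley ?lte_fin.
split=> //.
move/(congr1 (fun z => z - (2 * C)%:E)%E): E1.
by rewrite addeK// (addeC (2 * C)%:E) addeK.
Qed.

Lemma GammaS u : 1 < u -> Gamma (u + 1) = u * Gamma u.
Proof.
move=> u1; have [E fin] := integral_powR_expRS u u1.
rewrite /Gamma /Rintegral addrK E fineM// ge0_fin_numE//.
by apply: integral_ge0 => x _; rewrite lee_fin mulr_ge0 ?powR_ge0 ?expR_ge0.
Qed.

Lemma Gamma_gt0 u : 1 < u -> 0 < Gamma u.
Proof.
move=> u1; have [_ fin] := integral_powR_expRS u u1.
have mE (A : set R) := measurable_powR_expR (u - 1) A.
rewrite /Gamma /Rintegral fine_gt0// fin andbT.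
(* On [1, 2] one has x^(u-1) >= 1 and e^(-x) >= e^(-2). *)
apply: (@lt_le_trans _ _ (expR (- 2))%:E); first by rewrite lte_fin expR_gt0.
have -> : (expR (- 2))%:E = (\int[leb]_(x in `[1%R, 2%R]) (expR (- 2 : R))%:E)%E.
  rewrite integral_cst//= lebesgue_measure_itv/= lte_fin ltr1n -EFinB -EFinM.
  by congr EFin; ring.
apply: (@le_trans _ _ (\int[leb]_(x in `[1%R, 2%R]) (x `^ (u - 1) * expR (- x))%:E)%E).
  apply: ge0_le_integral => //.
  - exact: mE.
  - move=> x /=; rewrite in_itv/= => /andP[x1 x2]; rewrite lee_fin.
    rewrite -[leLHS]mul1r ler_pM ?expR_ge0 ?ler_expR ?lerN2//.
    by rewrite -[leLHS](powRr0 x) ler_powR// subr_ge0 ltW.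
apply: ge0_subset_integral => //.
- exact: mE.
- by move=> x _; rewrite lee_fin mulr_ge0 ?powR_ge0 ?expR_ge0.
- by move=> x /=; rewrite !in_itv/= andbT => /andP[x1 _]; apply: lt_le_trans x1.
Qed.

End gamma.

(** * Modulus, real and imaginary parts of complex numbers *)

Section complex_facts.
Context {R : realType}.
Implicit Types (x y z : R[i]).
Local Notation Re := complex.Re.
Local Notation Im := complex.Im.

Lemma ReD x y : Re (x + y) = Re x + Re y. Proof. by case: x y => [? ?] []. Qed.
Lemma ImD x y : Im (x + y) = Im x + Im y. Proof. by case: x y => [? ?] []. Qed.
Lemma cmodE x : cmod x = Num.sqrt (Re x ^+ 2 + Im x ^+ 2).
Proof. by case: x. Qed.

Lemma cmod_ge0 x : 0 <= cmod x. Proof. by rewrite cmodE sqrtr_ge0. Qed.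

Lemma cmodM x y : cmod (x * y) = cmod x * cmod y.
Proof. exact: ComplexField.Normc.normcM. Qed.

Lemma cmod_real (c : R) : cmod c%:C%C = `|c|.
Proof. by rewrite cmodE /= expr0n addr0 sqrtr_sqr. Qed.

Lemma cmodD x y : cmod (x + y) <= cmod x + cmod y.
Proof. by have := ler_normD x y; rewrite -rmorphD lecR. Qed.

Lemma cmodX x n : cmod (x ^+ n) = cmod x ^+ n.
Proof.
elim: n => [|n IH]; first by rewrite !expr0 (cmod_real 1) normr1.
by rewrite !exprS cmodM IH.
Qed.

Lemma normRe_le x : `|Re x| <= cmod x.
Proof. by rewrite cmodE -sqrtr_sqr ler_wsqrtr// lerDl sqr_ge0. Qed.

Lemma normIm_le x : `|Im x| <= cmod x.
Proof. by rewrite cmodE -sqrtr_sqr ler_wsqrtr// lerDr sqr_ge0. Qed.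

Lemma cmod_le x : cmod x <= `|Re x| + `|Im x|.
Proof.
rewrite cmodE -[leRHS]ger0_norm ?addr_ge0// -sqrtr_sqr ler_wsqrtr//.
rewrite -(real_normK (num_real (Re x))) -(real_normK (num_real (Im x))).
have := normr_ge0 (Re x); have := normr_ge0 (Im x); nra.
Qed.

Lemma cmod_sqrE x : cmod x ^+ 2 = Re x ^+ 2 + Im x ^+ 2.
Proof. by rewrite cmodE sqr_sqrtr// addr_ge0 ?sqr_ge0. Qed.

Lemma cvg_complex (a b : R ^nat) (l m : R) :
  a @ \oo --> l -> b @ \oo --> m ->
  (fun n => Complex (a n) (b n)) @ \oo --> (Complex l m : R[i]).
Proof.
move=> al bm; apply/cvgrPdist_lt => -[e e'].
rewrite ltcE/= => /andP[/eqP -> e0].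
have e20 : 0 < e / 2 by rewrite divr_gt0.
have Ha : \forall n \near \oo, `|l - a n| < e / 2 by move/cvgrPdist_lt: al; apply.
have Hb : \forall n \near \oo, `|m - b n| < e / 2 by move/cvgrPdist_lt: bm; apply.
near=> n.
suff : cmod (Complex l m - Complex (a n) (b n)) < e by rewrite -ltcR.
apply: (le_lt_trans (cmod_le _)) => /=.
have h1 : `|l - a n| < e / 2 by near: n; exact: Ha.
have h2 : `|m - b n| < e / 2 by near: n; exact: Hb.
lra.
Unshelve. all: by end_near. Qed.

End complex_facts.

(** * Fejér's argument: cosine-type sums with convex coefficients *)

Section fejer.
Context {R : realType}.
Local Notation Re := complex.Re.
Local Notation Im := complex.Im.
Variables (x : R[i]) (c : R^nat).
Hypothesis x1 : cmod x < 1.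
Hypothesis c_ni : forall n, c n.+1 <= c n.
Hypothesis c_convex : forall n, c n.+1 - c n.+2 <= c n - c n.+1.

Let geo n : R[i] := \sum_(i < n) x ^+ i.
(** For x = e^(i theta), [dirichlet] is the Dirichlet kernel D_n and [fejer] the Fejér kernel
    without its division by n, which is the form that summation by parts produces. *)
Let dirichlet n : R := 1 + 2 * Re (x * geo n).
Let fejer n : R := \sum_(j < n) dirichlet j.

Let geoS n : geo n.+1 = 1 + x * geo n.
Proof.
rewrite /geo big_ord_recl expr0; congr (_ + _).
by rewrite big_distrr; apply: eq_bigr => i _; rewrite /= exprS.
Qed.

Let dirichletS n : dirichlet n.+1 = dirichlet n + 2 * Re (x ^+ n.+1).
Proof.
by rewrite /dirichlet {1}/geo big_ord_recr/= mulrDr ReD exprS -/(geo n); ring.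
Qed.

(* On the unit circle this is the classical equality; inside the disc it
   becomes an inequality, so no polar decomposition of [x] is needed. *)
Let fejer_ge n : cmod (geo n) ^+ 2 <= fejer n.
Proof.
elim: n => [|n IH].
  by rewrite /geo /fejer !big_ord0 (cmod_real 0) normr0 expr0n.
rewrite /fejer big_ord_recr/= -/(fejer n) geoS.
have -> : cmod (1 + x * geo n) ^+ 2 = dirichlet n + cmod x ^+ 2 * cmod (geo n) ^+ 2.
  rewrite -exprMn -cmodM !cmod_sqrE /dirichlet ReD ImD /=; ring.
rewrite [leLHS]addrC lerD2r (le_trans _ IH)//.
by rewrite ler_piMl ?sqr_ge0// expr_le1 ?cmod_ge0// ltW.
Qed.

Let fejer_ge0 n : 0 <= fejer n.
Proof. by apply: le_trans (fejer_ge n); rewrite sqr_ge0. Qed.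

Let geo_bound n : cmod (geo n) <= (1 - cmod x)^-1.
Proof.
have r1 : 0 < 1 - cmod x by rewrite subr_gt0.
elim: n => [|n IH].
  by rewrite /geo big_ord0 (cmod_real 0) normr0 invr_ge0 ltW.
rewrite geoS (le_trans (cmodD _ _))// (cmod_real 1) normr1 cmodM.
apply: (@le_trans _ _ (1 + cmod x * (1 - cmod x)^-1)).
  by rewrite lerD2l ler_wpM2l ?cmod_ge0.
rewrite le_eqVlt; apply/orP; left; apply/eqP; field.
by rewrite gt_eqF.
Qed.

(** The bound degenerates as |x| tends to 1, but x is fixed while n grows: it only has to let the
    boundary term c_n D_n be controlled by a multiple of c_n. *)
Let dirichlet_bound n : - dirichlet n <= 1 + 2 * (1 - cmod x)^-1.
Proof.
rewrite /dirichlet.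
have := le_trans (normRe_le (x * geo n)) _.
move=> /(_ (1 - cmod x)^-1); rewrite cmodM => h.
have : `|Re (x * geo n)| <= (1 - cmod x)^-1.
  apply: h; rewrite -[leRHS]mul1r ler_pM ?cmod_ge0//; exact: ltW.
by rewrite ler_norml => /andP[? ?]; lra.
Qed.

(** Second summation by parts, as an inequality: by convexity c_n - c_{n+1} may be replaced by the
    smaller next difference in front of the nonnegative Fejér sum. *)
Let abel n : \sum_(k < n) (c k - c k.+1) * dirichlet k >= (c n - c n.+1) * fejer n.
Proof.
elim: n => [|n IH]; first by rewrite /fejer !big_ord0 mulr0.
rewrite big_ord_recr/=.
apply: (@le_trans _ _ ((c n - c n.+1) * (fejer n + dirichlet n))); last first.
  by rewrite mulrDr lerD2r.
by rewrite -[fejer n + _](_ : fejer n.+1 = _) ?ler_wpM2r// /fejer big_ord_recr.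
Qed.

(** First summation by parts, from 2 Re x^(k+1) = D_{k+1} - D_k. Subtracting [c 0] turns the initial
    term 2 c_0 into c_0 D_0, as D_0 = 1. *)
Let partial_sumE n : 2 * (\sum_(k < n.+1) c k * Re (x ^+ k)) - c 0%N =
  \sum_(k < n) (c k - c k.+1) * dirichlet k + c n * dirichlet n.
Proof.
elim: n => [|n IH].
  by rewrite big_ord_recr !big_ord0 /dirichlet /geo big_ord0 mulr0 /=; ring.
rewrite big_ord_recr/= mulrDr addrAC IH [in RHS]big_ord_recr/= dirichletS; ring.
Qed.

Lemma convex_partial_sum_Re_ge n : c n.+1 >= 0 ->
  c 0%N - c n * (1 + 2 * (1 - cmod x)^-1) <=
  2 * \sum_(k < n.+1) c k * Re (x ^+ k).
Proof.
move=> cn; have c0 : 0 <= c n by exact: le_trans (c_ni n).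
have := partial_sumE n; have := abel n.
have : 0 <= (c n - c n.+1) * fejer n by rewrite mulr_ge0 ?subr_ge0.
have : c n * - dirichlet n <= c n * (1 + 2 * (1 - cmod x)^-1) by rewrite ler_wpM2l.
by rewrite mulrN; lra.
Qed.

End fejer.

(** * The kernel series: coefficients, boundedness, real part *)

Section kernel.
Context {R : realType}.
Local Notation Re := (@complex.Re R).
Local Notation Im := (@complex.Im R).

Definition kcoef (u : R) (k : nat) : R := k`!%:R / pochhammer u k.

Variable u : R.
Hypothesis u2 : 2 < u.
Local Notation c := (kcoef u).

Lemma pochhammerS k : pochhammer u k.+1 = pochhammer u k * (u + k%:R).
Proof.
rewrite /pochhammer -natr1 addrA GammaS; first by rewrite -mulrA mulrC.
by apply: (@lt_le_trans _ _ u); [(move: u2; lra)|rewrite lerDl].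
Qed.

Lemma pochhammer_gt0 k : 0 < pochhammer u k.
Proof.
rewrite divr_gt0// Gamma_gt0//; last by (move: u2; lra).
by apply: (@lt_le_trans _ _ u); [(move: u2; lra)|rewrite lerDl].
Qed.

Let uk k : 0 < u + k%:R.
Proof. by rewrite ltr_wpDr//; (move: u2; lra). Qed.

Lemma kcoef_gt0 k : 0 < c k.
Proof. by rewrite divr_gt0 ?pochhammer_gt0// ltr0n fact_gt0. Qed.

Lemma kcoef0 : c 0 = 1.
Proof.
rewrite /kcoef /pochhammer addr0 divff ?divr1// gt_eqF// Gamma_gt0//; (move: u2; lra).
Qed.

Lemma kcoefS k : c k.+1 = c k * ((k%:R + 1) / (u + k%:R)).
Proof.
rewrite /kcoef pochhammerS factS natrM -natr1; field.
by rewrite !gt_eqF ?pochhammer_gt0.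
Qed.

Lemma kcoef_sub k : c k - c k.+1 = c k * ((u - 1) / (u + k%:R)).
Proof. by rewrite kcoefS; field; rewrite gt_eqF. Qed.

Lemma kcoef_ni k : c k.+1 <= c k.
Proof.
rewrite -subr_ge0 kcoef_sub mulr_ge0 ?ltW ?kcoef_gt0// divr_gt0//; (move: u2; lra).
Qed.

(** By [kcoef_sub] the difference is a product of two nonnegative decreasing factors, c_k and
    (u-1)/(u+k). *)
Lemma kcoef_convex k : c k.+1 - c k.+2 <= c k - c k.+1.
Proof.
have u1 : 0 < u - 1 by move: u2; lra.
rewrite !kcoef_sub; apply: ler_pM.
- exact/ltW/kcoef_gt0.
- by rewrite divr_ge0 ?ltW.
- exact: kcoef_ni.
- by rewrite ler_pM2l// lef_pV2 ?posrE// lerD2l ler_nat.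
Qed.

(* [c k] telescopes: [(u - 2) * c k = e k - e k.+1] for [e k = (k + u - 1) * c k]. *)
Lemma sum_kcoef n :
  (u - 2) * \sum_(k < n) c k = u - 1 - (n%:R + u - 1) * c n.
Proof.
elim: n => [|n IH]; first by rewrite big_ord0 kcoef0; ring.
rewrite big_ord_recr/= mulrDr IH kcoefS -natr1; field.
by rewrite gt_eqF.
Qed.

Lemma sum_kcoef_le n : \sum_(k < n) c k <= (u - 1) / (u - 2).
Proof.
rewrite ler_pdivlMr; last (move: u2; lra).
rewrite mulrC sum_kcoef gerBl mulr_ge0 ?ltW ?kcoef_gt0//.
by have : 0 <= n%:R :> R by []; move: u2; lra.
Qed.

(** Nonnegativity of the telescoped sum gives (n + u - 1) c_n <= u - 1, so c_n = O(1/n) without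
    asymptotics of Gamma. *)
Lemma cvg_kcoef : c @ \oo --> (0 : R).
Proof.
have cle n : c n <= (u - 1) / (n%:R + 1).
  have n0 : 0 <= n%:R :> R by [].
  rewrite ler_pdivlMr; last by (move: u2; lra).
  have : 0 <= (u - 2) * \sum_(k < n) c k.
    by rewrite mulr_ge0 ?sumr_ge0// => [|i _]; [(move: u2; lra)|exact/ltW/kcoef_gt0].
  rewrite sum_kcoef; have := kcoef_gt0 n; move: u2; nra.
apply: (@squeeze_cvgr _ _ _ _ (cst 0) (fun n => (u - 1) / (n%:R + 1))).
- by near=> n; rewrite /= cle ltW ?kcoef_gt0.
- exact: cvg_cst.
- rewrite -[X in _ --> X](mulr0 (u - 1)); apply: cvgMr.
  have := @cvg_harmonic R; rewrite /harmonic.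
  by under eq_fun do rewrite -natr1.
Unshelve. all: by end_near. Qed.

Variable x : R[i].
Hypothesis x1 : cmod x < 1.

Let kterm k : R[i] := (c k)%:C%C * x ^+ k.

(** Here [f] stands for [Re] or [Im]: the two real series are dominated by the sum of the c_k, and
    [lim_kernel_series] reassembles them. *)
Let cvg_ksum (f : R[i] -> R) : (forall z, `|f z| <= cmod z) ->
  cvgn (series (fun k => c k * f (x ^+ k))).
Proof.
move=> fle; apply: normed_cvg; apply: nondecreasing_is_cvgn.
  by apply/nondecreasing_seqP => n; rewrite [leRHS]seriesSr lerDl normr_ge0.
exists ((u - 1) / (u - 2)) => _ [n _ <-] /=.
apply: le_trans (sum_kcoef_le n).
rewrite seriesEord/= ler_sum// => i _.
rewrite normrM gtr0_norm ?kcoef_gt0//; apply: ler_piMr; first exact/ltW/kcoef_gt0.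
by rewrite (le_trans (fle _))// cmodX exprn_ile1 ?cmod_ge0// ltW.
Qed.

Let ksum (f : R[i] -> R) := limn (series (fun k => c k * f (x ^+ k))).

Let ksum_le (f : R[i] -> R) : (forall z, `|f z| <= cmod z) ->
  `|ksum f| <= (u - 1) / (u - 2).
Proof.
move=> fle; have cf := cvg_ksum f fle.
apply: (cvgr_to_le (cvg_norm cf)).
near=> n; apply: le_trans (sum_kcoef_le n).
rewrite seriesEord/= (le_trans (ler_norm_sum _ _ _))// ler_sum// => i _.
rewrite normrM gtr0_norm ?kcoef_gt0//; apply: ler_piMr; first exact/ltW/kcoef_gt0.
by rewrite (le_trans (fle _))// cmodX exprn_ile1 ?cmod_ge0// ltW.
Unshelve. all: by end_near. Qed.

Lemma lim_kernel_series : limn (series kterm) = Complex (ksum Re) (ksum Im).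
Proof.
apply/cvg_lim => //.
have -> : series kterm = (fun n => Complex
    (series (fun k => c k * Re (x ^+ k)) n) (series (fun k => c k * Im (x ^+ k)) n)).
  apply/funext => n; rewrite !seriesEnat/=; elim: n => [|n IH]; first by rewrite !big_geq.
  rewrite !big_nat_recr//= IH /kterm.
  by case: (x ^+ n) => a b; congr Complex; rewrite /=; ring.
by apply: cvg_complex; apply: cvg_ksum; [exact: normRe_le|exact: normIm_le].
Qed.

Lemma cmod_kernel_series :
  cmod (limn (series kterm)) <= 2 * ((u - 1) / (u - 2)).
Proof.
rewrite lim_kernel_series (le_trans (cmod_le _))//= mulr_natl mulr2n.
by apply: lerD; apply: ksum_le; [exact: normRe_le|exact: normIm_le].
Qed.

Lemma Re_kernel_series : 2^-1 <= Re (limn (series kterm)).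
Proof.
rewrite lim_kernel_series/=.
have cf := cvg_ksum Re (@normRe_le R).
(* [c n * B] dominates -c_n D_n, the boundary term of the summation by parts, and tends to 0; the
   lower bound for the doubled partial sums then tends to c_0 = 1. *)
pose B := 1 + 2 * (1 - cmod x)^-1.
suff : 1 <= 2 * ksum Re by lra.
have cB : (fun n => 1 - c n * B) @ \oo --> (1 - 0 * B : R).
  by apply: cvgB; [exact: cvg_cst|apply: cvgMl; exact: cvg_kcoef].
rewrite mul0r subr0 in cB.
have cf2 : (fun n => 2 * series (fun k => c k * Re (x ^+ k)) n.+1) @ \oo --> 2 * ksum Re.
  by apply: cvgMr; rewrite (cvg_shiftS (series _)).
apply: (ler_cvg_to cB cf2); near=> n.
rewrite seriesEord/=.
have := convex_partial_sum_Re_ge x c x1 kcoef_ni kcoef_convex n (ltW (kcoef_gt0 _)).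
by rewrite kcoef0.
Unshelve. all: by end_near. Qed.

End kernel.

(** * Comparison of integrals of arbitrary functions *)

Section integral_without_measurability.
Context d (T : measurableType d) (R : realType).
Variable mu : {measure set T -> \bar R}.
Local Open Scope ereal_scope.
Implicit Types (D : set T) (f g : T -> \bar R).

(* No measurability is assumed: the integral of a nonnegative function is a
   supremum over the simple functions below it.  This avoids proving that
   [bop s t f] is measurable. *)
Lemma ge0_ae_le_integral D f g :
  (forall x, D x -> 0 <= f x) -> (forall x, D x -> 0 <= g x) ->
  {ae mu, forall x, D x -> f x <= g x} ->
  \int[mu]_(x in D) f x <= \int[mu]_(x in D) g x.
Proof.
move=> f0 g0 [N [mN N0 fgN]].
rewrite [leLHS]ge0_integralE//; apply: ge_ereal_sup => _ [h /= hf <-].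
rewrite -[in leLHS](patch_setT (fun=> 0%R) h) -(integral_nnsfun mu measurableT h).
(* Setting [h] to 0 on the exceptional null set keeps its integral and puts it below [g]
   everywhere. *)
rewrite (ae_eq_integral ((EFin \o h) \_ (~` N)))//=.
- rewrite [leRHS]integral_mkcond.
  rewrite 2?ge0_integralTE; last 2 first.
  - by move=> x; apply: erestrict_ge0.
  - by move=> x; apply: erestrict_ge0 => y _; rewrite lee_fin.
  apply: le_ereal_sup => _ [k /= kh <-]; exists k => //= x.
  apply: (le_trans (kh x)); rewrite !patchE.
  case: ifPn => [|_]; last by case: ifPn => //; rewrite inE => /g0.
  rewrite inE => Nx; apply: (le_trans (hf x)); rewrite patchE.
  case: ifPn => //; rewrite inE => Dx.
  by apply: contrapT => fg; apply: Nx; apply: fgN => /(_ Dx).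
- by apply/measurable_EFinP.
- apply/(measurable_restrictT _ _).1; first exact: measurableC.
  by apply: measurable_funTS; apply/measurable_EFinP.
- exists N; split => // x /= nfg; apply: contrapT => Nx; apply: nfg => _.
  by rewrite patchE mem_set.
Qed.

Lemma ge0_le_integral_dom D f g :
  (forall x, D x -> 0 <= f x) -> (forall x, D x -> f x <= g x) ->
  \int[mu]_(x in D) f x <= \int[mu]_(x in D) g x.
Proof.
move=> f0 fg; apply: ge0_ae_le_integral => //; last exact: aeW.
by move=> x Dx; apply: le_trans (fg x Dx); exact: f0.
Qed.

Lemma ae_eq_integral_dom D f g :
  {ae mu, forall x, D x -> f x = g x} ->
  \int[mu]_(x in D) f x = \int[mu]_(x in D) g x.
Proof.
have posneg (u v : T -> \bar R) : {ae mu, forall x, D x -> u x = v x} ->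
    (forall x, D x -> 0 <= u x) -> (forall x, D x -> 0 <= v x) ->
    \int[mu]_(x in D) u x = \int[mu]_(x in D) v x.
  move=> uv u0 v0; apply/eqP; rewrite eq_le; apply/andP; split;
    apply: ge0_ae_le_integral => //;
    by apply: filterS uv => x uv Dx; rewrite uv.
move=> fg; rewrite [LHS]integralE [RHS]integralE; congr (_ - _); apply: posneg => //.
- by apply: filterS fg => x fg Dx; rewrite !funeposE fg.
- by apply: filterS fg => x fg Dx; rewrite !funenegE fg.
Qed.

(** The integrals of f^+ and f^- both lie in [0, M], so their difference lies in [-M, M]. This
    applies directly to the integrand of [bop], whose kernel factor is never shown measurable. *)
Lemma Rintegral_bound D (f : T -> R) (M : R) :
  \int[mu]_(x in D) `|f x|%:E <= M%:E -> (`|\int[mu]_(x in D) f x| <= M)%R.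
Proof.
move=> fM; rewrite /Rintegral integralE.
have hp : \int[mu]_(x in D) (fun x => (f x)%:E)^\+ x <= M%:E.
  apply: le_trans fM; apply: ge0_le_integral_dom => // x _.
  by rewrite funeposE -EFin_max lee_fin ge_max ler_norm normr_ge0.
have hn : \int[mu]_(x in D) (fun x => (f x)%:E)^\- x <= M%:E.
  apply: le_trans fM; apply: ge0_le_integral_dom => // x _.
  by rewrite funenegE -EFinN -EFin_max lee_fin ge_max normr_ge0 -normrN ler_norm.
move: hp hn; set P := integral _ _ _; set N := integral _ _ _.
have P0 : 0 <= P by apply: integral_ge0.
have N0 : 0 <= N by apply: integral_ge0.
move: P N P0 N0 => [P||] [N||]//; rewrite !lee_fin => P0 N0 PM NM.
by rewrite /= ler_norml; lra.
Qed.

End integral_without_measurability.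

(** * Hölder's inequality on a measurable subset *)

Section hoelder_on.
Context d (T : measurableType d) (R : realType).
Variable mu : {measure set T -> \bar R}.
Local Open Scope ereal_scope.

Lemma hoelder_on (D : set T) (f g : T -> R) (p q : R) :
  measurable D -> measurable_fun D f -> measurable_fun D g ->
  (forall x, D x -> 0 <= f x)%R -> (forall x, D x -> 0 <= g x)%R ->
  (0 < p)%R -> (0 < q)%R -> (p^-1 + q^-1 = 1)%R ->
  \int[mu]_(x in D) (f x * g x)%:E <=
  (\int[mu]_(x in D) (f x `^ p)%:E) `^ p^-1 *
  (\int[mu]_(x in D) (g x `^ q)%:E) `^ q^-1.
Proof.
move=> mD mf mg f0 g0 p0 q0 pq.
have := @hoelder _ _ _ mu (f \_ D) (g \_ D) p q.
have mf' : measurable_fun setT (f \_ D) by exact/(measurable_restrictT _ _).1.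
have mg' : measurable_fun setT (g \_ D) by exact/(measurable_restrictT _ _).1.
move=> /(_ mf' mg' p0 q0 pq); rewrite Lnorm1 unlock /=.
(* Extension by 0 outside [D] is harmless because 0^r = 0 for r > 0. *)
have restr (h : T -> R) (r : R) : (forall x, D x -> 0 <= h x)%R -> (0 < r)%R ->
    \int[mu]_x (`|(h \_ D) x| `^ r)%:E = \int[mu]_(x in D) (h x `^ r)%:E.
  move=> h0 r0; rewrite [RHS]integral_mkcond; apply: eq_integral => x _.
  rewrite !patchE; case: ifPn => [|_]; last by rewrite normr0 powR0 ?gt_eqF.
  by rewrite inE => /h0 hx; rewrite ger0_norm.
rewrite !restr//; congr (_ <= _).
rewrite [RHS]integral_mkcond; apply: eq_integral => x _.
rewrite !patchE; case: ifPn => [|_]; last by rewrite /= mulr0 normr0.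
by rewrite inE => Dx; rewrite /= ger0_norm ?mulr_ge0 ?f0 ?g0.
Qed.

End hoelder_on.

(** * Measurability on the ball, kernel bounds, exhaustion *)

Section ball.
Context {R : realType} {N : nat}.
Local Notation CN := (N.-tuple R[i]).
Local Notation mu := (@ball_measure R N).
Local Notation D := (@uball R N).
Local Notation Re := (@complex.Re R).
Local Notation Im := (@complex.Im R).
Implicit Types z w : CN.

Lemma measurable_Re : measurable_fun setT Re.
Proof.
exact: (measurableT_comp measurable_fst (@measurable_pair_of_complex R)).
Qed.

Lemma measurable_Im : measurable_fun setT Im.
Proof.
exact: (measurableT_comp measurable_snd (@measurable_pair_of_complex R)).
Qed.

Lemma measurable_real_complex :
  measurable_fun setT (fun r : R => r%:C%C : R[i]).
Proof.
have m0 : measurable_fun setT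
    (fun r : measurableTypeR R => (r, 0 : measurableTypeR R)).
  by apply: measurable_fun_pair; [exact: measurable_id|exact: measurable_cst].
exact: (measurableT_comp (@measurable_complex_of_pair R) m0).
Qed.

Lemma measurable_cmod : measurable_fun setT (@cmod R).
Proof.
rewrite (_ : cmod = fun x => Num.sqrt (Re x ^+ 2 + Im x ^+ 2)); last first.
  by apply/funext => x; rewrite cmodE.
apply: (measurableT_comp (continuous_measurable_fun (@sqrt_continuous R))).
apply: measurable_funD; apply: measurable_funX.
  exact: measurable_Re.
exact: measurable_Im.
Qed.

Lemma Re_sum (I : Type) (r : seq I) (P : pred I) (F : I -> R[i]) :
  Re (\sum_(i <- r | P i) F i) = \sum_(i <- r | P i) Re (F i).
Proof. by apply: (big_morph Re (@ReD R)). Qed.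

Lemma vnormE z : vnorm z = Num.sqrt (\sum_(j < N) cmod (tnth z j) ^+ 2).
Proof.
rewrite /vnorm /hdot Re_sum; congr Num.sqrt; apply: eq_bigr => j _.
by rewrite cmod_sqrE; case: (tnth z j) => a b /=; ring.
Qed.

Lemma vnorm_ge0 z : 0 <= vnorm z. Proof. exact: sqrtr_ge0. Qed.

Lemma measurable_vnorm : measurable_fun setT (@vnorm R N).
Proof.
rewrite (_ : vnorm = fun z => Num.sqrt (\sum_(j < N) cmod (tnth z j) ^+ 2)).
  apply: (measurableT_comp (continuous_measurable_fun (@sqrt_continuous R))).
  apply: measurable_sum => j; apply: measurable_funX.
  by apply: (measurableT_comp measurable_cmod); exact: measurable_tnth.
by apply/funext => z; rewrite vnormE.
Qed.

Lemma measurable_uball : measurable D.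
Proof.
have -> : D = setT `&` vnorm @^-1` `]-oo, (1 : R)[%classic.
  by rewrite setTI; apply/seteqP; split => z; rewrite /uball/= in_itv.
exact: measurable_vnorm.
Qed.

Lemma cmod_hdot_lt1 z w : D z -> D w -> cmod (hdot z w) < 1.
Proof.
rewrite /uball/= !vnormE => z1 w1.
have sum_lt1 (v : CN) : Num.sqrt (\sum_(j < N) cmod (tnth v j) ^+ 2) < 1 ->
    \sum_(j < N) cmod (tnth v j) ^+ 2 < 1.
  by move=> h; rewrite ltNge; apply/negP => /ler_wsqrtr; rewrite sqrtr1 leNgt h.
move/sum_lt1 : z1; move/sum_lt1 : w1 => w1 z1.
(* AM-GM on each term replaces Cauchy-Schwarz. *)
suff : 2 * cmod (hdot z w) <=
    \sum_(j < N) cmod (tnth z j) ^+ 2 + \sum_(j < N) cmod (tnth w j) ^+ 2 by lra.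
rewrite -big_split/= /hdot.
elim/big_ind2 : _ => [|a b x y ax by_|j _].
- by rewrite (cmod_real 0) normr0 mulr0.
- by have := cmodD a x; lra.
have -> : cmod (tnth z j * (tnth w j)^*%C) = cmod (tnth z j) * cmod (tnth w j).
  by rewrite cmodM; congr (_ * _); case: (tnth w j) => a b; rewrite !cmodE/= sqrrN.
by have := sqr_ge0 (cmod (tnth z j) - cmod (tnth w j)); rewrite sqrrB -mulr_natl; lra.
Qed.

Lemma bkernel_bounds (a : R) : a < - (N%:R + 1) ->
  exists2 C : R, 0 < C & forall z w, D z -> D w ->
    cmod (bkernel a z w) <= C /\ 2^-1 <= Re (bkernel a z w).
Proof.
move=> aN; pose u : R := 1 - N%:R - a; have u2 : 2 < u by rewrite /u; lra.
exists (2 * ((u - 1) / (u - 2))).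
  by rewrite mulr_gt0// divr_gt0; lra.
move=> z w /cmod_hdot_lt1 /[apply] zw.
split; [exact: (cmod_kernel_series u u2 _ zw)|exact: (Re_kernel_series u u2 _ zw)].
Qed.

Lemma wt_gt0 (c : R) z : D z -> 0 < wt c z.
Proof.
rewrite /uball/= => z1; rewrite powR_gt0// subr_gt0 expr_lt1//.
exact: vnorm_ge0.
Qed.

Lemma wt_ge0 (c : R) z : 0 <= wt c z. Proof. exact: powR_ge0. Qed.

Lemma measurable_wt (c : R) : measurable_fun setT (@wt R N c).
Proof.
apply: (measurableT_comp (measurable_powR c)).
by apply: measurable_funB => //; apply: measurable_funX; exact: measurable_vnorm.
Qed.

(** Supplies the sets of finite measure on which the extremal function is truncated; they come from
    the unscaled measure, since scaling by a real factor keeps them finite. *)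
Lemma ball_measure_exhaustion : exists F : (set CN)^nat,
  [/\ \bigcup_n F n = setT, nondecreasing_seq F &
      forall n, measurable (F n) /\ (mu (F n) < +oo)%E].
Proof.
have /sigma_finiteP[F [TF ndF Foo]] :=
  sigma_finiteT (tuple_measure (@complex_lebesgue R) N).
exists F; split => // n; have [mF Fn] := Foo n; split=> //.
rewrite /ball_measure/= /mscale/=.
by rewrite lte_mul_pinfty// ?lee_fin ?invr_ge0 ?fine_ge0.
Qed.

End ball.

(** * Pointwise bounds for the operator *)

Section operator.
Context {R : realType} {N : nat}.
Local Notation CN := (N.-tuple R[i]).
Local Notation mu := (@ball_measure R N).
Local Notation D := (@uball R N).
Local Notation Re := (@complex.Re R).
Local Notation Im := (@complex.Im R).
Implicit Types (z w : CN) (f : CN -> R[i]) (omega : CN -> R).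

Lemma wtD (a b : R) z : D z -> wt (a + b) z = wt a z * wt b z.
Proof.
move=> Dz; rewrite /wt powRD//; apply/implyP => _.
rewrite gt_eqF// subr_gt0 expr_lt1//; exact: vnorm_ge0.
Qed.

Lemma wt_powR (a b : R) z : wt a z `^ b = wt (a * b) z.
Proof. by rewrite /wt powRrM. Qed.

Lemma measurable_real_integrand (g : CN -> R) (c : R) :
  measurable_fun D g -> measurable_fun D (fun z => g z * wt c z).
Proof.
move=> mg; apply: measurable_funM => //.
by apply: measurable_funTS; exact: measurable_wt.
Qed.

Lemma measurable_cmod_on f : measurable_fun D f -> measurable_fun D (cmod \o f).
Proof. by move=> mf; apply: measurableT_comp => //; exact: measurable_cmod. Qed.

Lemma mu_integral_ge0 (c : R) (g : CN -> R) : (forall z, D z -> 0 <= g z) ->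
  (0 <= mu_integral c g)%E.
Proof.
move=> g0; apply: integral_ge0 => z Dz.
by rewrite lee_fin mulr_ge0 ?wt_ge0 ?g0.
Qed.

Lemma mu_integralZl (c k : R) (g : CN -> R) : measurable_fun D g ->
  (forall z, D z -> 0 <= g z) -> 0 <= k ->
  mu_integral c (fun z => k * g z) = (k%:E * mu_integral c g)%E.
Proof.
move=> mg g0 k0; rewrite /mu_integral -ge0_integralZl//.
- by apply: eq_integral => z _; rewrite -mulrA EFinM.
- exact: measurable_uball.
- by apply/measurable_EFinP; exact: measurable_real_integrand.
- by move=> z Dz; rewrite lee_fin mulr_ge0 ?wt_ge0 ?g0.
Qed.

Lemma wnorm_ge0 (p c : R) omega f : (0 <= wnorm p c omega f)%E.
Proof. exact: poweR_ge0. Qed.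

Lemma integral_hoelder (p q s : R) omega f : 1 < p ->
  measurable_fun D omega -> (forall z, 0 < omega z) -> measurable_fun D f ->
  (mu_integral s (cmod \o f) <= wnorm p q omega f *
   mu_integral (q + p / (p - 1) * (s - q))
     (fun z => (omega z `^ (- 1 / (p - 1)))%R) `^ ((p - 1) / p))%E.
Proof.
move=> p1 mw w0 mf.
have p0 : 0 < p by lra.
have p10 : 0 < p - 1 by lra.
(* [F] carries the norm, F^p = |f|^p omega wt_q, and [G] is what is left of |f| wt_s. Raising [G] to
   the power p' = p/(p-1) yields the dual weight, with exponent (s - q/p) p' = q + p' (s - q). *)
pose F z := cmod (f z) * omega z `^ p^-1 * wt (q / p) z.
pose G z := omega z `^ (- p^-1) * wt (s - q / p) z.
have mpow r : measurable_fun D (fun z => omega z `^ r).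
  exact: (measurableT_comp (measurable_powR r) mw).
have pE : (p / (p - 1))^-1 = (p - 1) / p by field; rewrite !gt_eqF.
have e1 : (\int[mu]_(z in D) (F z * G z)%:E = mu_integral s (cmod \o f))%E.
  apply: eq_integral => z; rewrite inE => Dz; congr EFin.
  rewrite /F /G /= powRN -[in RHS](subrK (q / p) s) [in RHS]wtD//.
  by field; rewrite gt_eqF ?powR_gt0.
have e2 : ((\int[mu]_(z in D) (F z `^ p)%:E) `^ p^-1 = wnorm p q omega f)%E.
  congr (_ `^ _)%E; apply: eq_integral => z; rewrite inE => Dz; congr EFin.
  rewrite /F !powRM ?mulr_ge0 ?cmod_ge0 ?powR_ge0 ?wt_ge0//.
  by rewrite -powRrM mulVf ?gt_eqF// powRr1 ?ltW// wt_powR divfK ?gt_eqF.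
have e3 : (\int[mu]_(z in D) (G z `^ (p / (p - 1)))%:E =
    mu_integral (q + p / (p - 1) * (s - q))
      (fun z => (omega z `^ (- 1 / (p - 1)))%R))%E.
  apply: eq_integral => z; rewrite inE => Dz; congr EFin.
  rewrite /G powRM ?powR_ge0 ?wt_ge0// -powRrM wt_powR.
  have -> : - p^-1 * (p / (p - 1)) = - 1 / (p - 1) by field; rewrite !gt_eqF.
  suff -> : (s - q / p) * (p / (p - 1)) = q + p / (p - 1) * (s - q) by [].
  by field; rewrite !gt_eqF.
rewrite -e1 -e2 -e3 -pE; apply: hoelder_on => //.
- exact: measurable_uball.
- apply: measurable_real_integrand; apply: measurable_funM => //.
  exact: measurable_cmod_on.
- exact: measurable_real_integrand.
- by move=> z _; rewrite !mulr_ge0 ?cmod_ge0 ?powR_ge0 ?wt_ge0.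
- by move=> z _; rewrite !mulr_ge0 ?powR_ge0 ?wt_ge0.
- by rewrite divr_gt0.
- by field; rewrite !gt_eqF.
Qed.

Lemma cmod_bop_integrand (s t : R) f z w :
  cmod (bop_integrand s t f z w) =
  cmod (bkernel (s + t) z w) * (cmod (f w) * wt s w).
Proof.
by rewrite /bop_integrand !cmodM cmod_real ger0_norm ?wt_ge0// mulrA.
Qed.

Lemma integral_bop_integrand_le (s t C I : R) f z : 0 <= C ->
  (forall w, D w -> cmod (bkernel (s + t) z w) <= C) ->
  measurable_fun D f -> (mu_integral s (cmod \o f) <= I%:E)%E ->
  (\int[mu]_(w in D) (cmod (bop_integrand s t f z w))%:E <= (C * I)%:E)%E.
Proof.
move=> C0 KC mf fI.
apply: (@le_trans _ _ (mu_integral s (fun w => C * cmod (f w)))).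
  apply: ge0_le_integral_dom => w Dw; rewrite lee_fin ?cmod_ge0//.
  rewrite cmod_bop_integrand -mulrA ler_wpM2r ?mulr_ge0 ?cmod_ge0 ?wt_ge0//.
  exact: KC.
rewrite mu_integralZl//.
- by rewrite EFinM lee_wpmul2l// lee_fin.
- exact: measurable_cmod_on.
- by move=> w _; exact: cmod_ge0.
Qed.

Lemma cmod_bop_le (s t C I : R) f z : 0 <= C ->
  (forall w, D w -> cmod (bkernel (s + t) z w) <= C) ->
  measurable_fun D f -> (mu_integral s (cmod \o f) <= I%:E)%E ->
  cmod (bop s t f z) <= wt t z * (2 * (C * I)).
Proof.
move=> C0 KC mf fI; rewrite /bop cmodM cmod_real ger0_norm ?wt_ge0//.
(* The complex integral is a pair of real ones, each at most C I in absolute value; hence the factor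
   2. *)
rewrite ler_wpM2l ?wt_ge0// (le_trans (cmod_le _))//= mulr_natl mulr2n.
have h := integral_bop_integrand_le s t C I f z C0 KC mf fI.
apply: lerD; apply: Rintegral_bound; apply: le_trans h;
  apply: ge0_le_integral_dom => w Dw; rewrite lee_fin ?normr_ge0//.
  exact: normRe_le.
exact: normIm_le.
Qed.

Lemma cmod_bop_ge (s t C : R) (g : CN -> R) z : D z -> 0 <= C ->
  (forall w, D w -> cmod (bkernel (s + t) z w) <= C /\
                    2^-1 <= Re (bkernel (s + t) z w)) ->
  measurable_fun D (fun w => (g w)%:C%C) -> (forall w, D w -> 0 <= g w) ->
  measurable_fun D g -> forall I, mu_integral s g = I%:E ->
  wt t z * (2^-1 * I) <= cmod (bop s t (fun w => (g w)%:C%C) z).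
Proof.
move=> Dz C0 KC mgC g0 mg I gI.
rewrite /bop cmodM cmod_real ger0_norm ?wt_ge0// ler_wpM2l ?wt_ge0//.
(* Only the real part is kept: as [g] is real, it involves Re K alone. *)
apply: le_trans (normRe_le _); apply: le_trans (ler_norm _) => /=.
set f := fun w => (g w)%:C%C.
have fI : (mu_integral s (cmod \o f) <= I%:E)%E.
  rewrite -gI /mu_integral le_eqVlt; apply/orP; left; apply/eqP.
  apply: eq_integral => w; rewrite inE => Dw.
  by rewrite /f /comp cmod_real ger0_norm ?g0.
have h := integral_bop_integrand_le s t C I f z C0 (fun w Dw => (KC w Dw).1) mgC fI.
have ReE w : Re (bop_integrand s t f z w) = Re (bkernel (s + t) z w) * (g w * wt s w).
  rewrite /bop_integrand /f; case: (bkernel _ _ _) => a b /=; ring.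
have ge w : D w -> 2^-1 * (g w * wt s w) <= Re (bop_integrand s t f z w).
  move=> Dw; rewrite ReE ler_wpM2r ?mulr_ge0 ?g0 ?wt_ge0//.
  by have [] := KC w Dw.
have ge0 w : D w -> 0 <= Re (bop_integrand s t f z w).
  by move=> Dw; apply: le_trans (ge w Dw); rewrite !mulr_ge0 ?g0 ?wt_ge0.
(* An infinite integral would be sent to 0 by [fine]; the bound C on the kernel excludes this. *)
rewrite /Rintegral -lee_fin fineK; last first.
  rewrite ge0_fin_numE; last by apply: integral_ge0 => w Dw; rewrite lee_fin ge0.
  apply: le_lt_trans (ltry (C * I)); apply: le_trans h.
  apply: ge0_le_integral_dom => w Dw; rewrite lee_fin ?ge0//.
  by apply: le_trans (normRe_le _); exact: ler_norm.
rewrite EFinM -gI -mu_integralZl//.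
apply: ge0_le_integral_dom => w Dw; rewrite lee_fin -mulrA ?ge//.
by rewrite !mulr_ge0 ?g0 ?wt_ge0.
Qed.

(** Origin of the exponent Q + p t: the factor wt_t in front of the operator, raised to the power p,
    joins the density wt_Q of the target space. *)
Lemma mu_integral_wt_powR (p Q t k : R) omega : 0 < p -> 0 <= k ->
  measurable_fun D omega -> (forall z, 0 < omega z) ->
  mu_integral Q (fun z => (wt t z * k) `^ p * omega z) =
  ((k `^ p)%:E * mu_integral (Q + p * t) omega)%E.
Proof.
move=> p0 k0 mw w0; rewrite -mu_integralZl ?powR_ge0//; last by move=> z _; exact/ltW.
apply: eq_integral => z; rewrite inE => Dz; congr EFin.
by rewrite powRM ?wt_ge0// wt_powR wtD// (mulrC p); ring.
Qed.

End operator.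

Lemma lee_poweR {R : realType} (r : R) (x y : \bar R) :
  0 <= r -> (0 <= x -> x <= y -> x `^ r <= y `^ r)%E.
Proof.
move=> r0 x0 xy; apply: gt0_ler_poweR => //; rewrite in_itv/= leey andbT//.
exact: le_trans xy.
Qed.

(** * Upper bound, for everywhere positive weights *)

Section positive_weight.
Context {R : realType} {N : nat}.
Local Notation CN := (N.-tuple R[i]).
Local Notation mu := (@ball_measure R N).
Local Notation D := (@uball R N).
Local Notation Re := (@complex.Re R).
Implicit Types (z w : CN) (f : CN -> R[i]) (omega : CN -> R).

Lemma bop_upper (p q Q s t C a b : R) omega : 1 < p -> 0 <= C ->
  measurable_fun D omega -> (forall z, 0 < omega z) ->
  (forall z w, D z -> D w -> cmod (bkernel (s + t) z w) <= C) ->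
  mu_integral (Q + p * t) omega = a%:E ->
  mu_integral (q + p / (p - 1) * (s - q))
    (fun z => (omega z `^ (- 1 / (p - 1)))%R) = b%:E ->
  bop_well_defined p q s t omega /\
  bop_bounded_by p q Q s t omega (2 * C * (a * b `^ (p - 1)) `^ p^-1).
Proof.
move=> p1 C0 mw w0 KC Aa Bb.
have p0 : 0 < p by lra.
have a0 : 0 <= a by rewrite -lee_fin -Aa mu_integral_ge0// => z _; exact/ltW.
have b0 : 0 <= b.
  by rewrite -lee_fin -Bb mu_integral_ge0// => z _; exact: powR_ge0.
have key f : in_wLp p q omega f -> exists n : R, [/\ 0 <= n, wnorm p q omega f = n%:E &
    (mu_integral s (cmod \o f) <= (n * b `^ ((p - 1) / p))%:E)%E].
  move=> [mf fin]; have n0 := wnorm_ge0 p q omega f.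
  exists (fine (wnorm p q omega f)); rewrite fineK ?ge0_fin_numE//.
  split=> //; first exact: fine_ge0.
  rewrite EFinM fineK ?ge0_fin_numE// -poweR_EFin -Bb.
  exact: integral_hoelder.
split=> f fw; have [n [n0 nE fI]] := key f fw; have [mf _] := fw.
  (* Absolute convergence holds at every point of the ball, not merely almost everywhere. *)
  apply: aeW => z Dz; apply: le_lt_trans (ltry _).
  exact: (integral_bop_integrand_le s t C _ f z C0 (KC z ^~ Dz) mf fI).
set I := n * _ in fI; have I0 : 0 <= I by rewrite mulr_ge0 ?powR_ge0.
have I1 : 0 <= 2 * (C * I) by apply: mulr_ge0 => //; apply: mulr_ge0.
apply: (@le_trans _ _ (mu_integral Q
   (fun z => ((wt t z * (2 * (C * I))) `^ p * omega z)%R) `^ p^-1)%E).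
  apply: lee_poweR; first by rewrite invr_ge0 ltW.
    by apply: mu_integral_ge0 => z _; rewrite mulr_ge0 ?powR_ge0// ltW.
  apply: ge0_le_integral_dom => z Dz.
    by rewrite lee_fin !mulr_ge0 ?powR_ge0 ?wt_ge0// ltW.
  rewrite lee_fin ler_wpM2r ?wt_ge0// ler_wpM2r ?(ltW (w0 _))//.
  apply: ge0_ler_powR; rewrite ?nnegrE; [exact: ltW|exact: cmod_ge0|by rewrite mulr_ge0 ?wt_ge0|].
  exact: (cmod_bop_le s t C I f z C0 (KC z ^~ Dz) mf fI).
rewrite (mu_integral_wt_powR p Q t _ omega p0 I1 mw w0) Aa -EFinM poweR_EFin nE -EFinM lee_fin.
rewrite (powRM _ (powR_ge0 _ _) a0) -powRrM mulfV ?gt_eqF// powRr1//.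
rewrite (powRM _ a0 (powR_ge0 _ _)) -powRrM /I.
by rewrite le_eqVlt; apply/orP; left; apply/eqP; ring.
Qed.

End positive_weight.

(** * Lower bound by truncated extremal functions *)

Section lower.
Context {R : realType} {N : nat}.
Local Notation CN := (N.-tuple R[i]).
Local Notation mu := (@ball_measure R N).
Local Notation D := (@uball R N).
Local Notation Re := (@complex.Re R).
Implicit Types (z w : CN) (f : CN -> R[i]) (omega : CN -> R).

(** Truncating to the part of a set of finite measure where g <= n makes the integral finite; these
    sets increase to the ball, so monotone convergence recovers the full integral even when it is
    infinite. *)
Lemma integral_exhaustion (g : CN -> R) : measurable_fun D g ->
  (forall z, D z -> 0 <= g z) ->
  exists E : (set CN)^nat, [/\ forall n, measurable (E n),
    forall n, (\int[mu]_(z in D) ((g \_ (E n)) z)%:E < +oo)%E &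
    (\int[mu]_(z in D) ((g \_ (E n)) z)%:E @[n --> \oo] -->
      \int[mu]_(z in D) (g z)%:E)%E].
Proof.
move=> mg g0; have [F [UF ndF Foo]] := @ball_measure_exhaustion R N.
pose E n := F n `&` (D `&` g @^-1` `]-oo, n%:R]).
have mE n : measurable (E n).
  apply: measurableI; first by case: (Foo n).
  exact: (mg measurable_uball).
have gE n z : D z -> (0 <= (g \_ (E n)) z).
  by move=> Dz; rewrite patchE; case: ifPn => // _; exact: g0.
have mgE n : measurable_fun D (g \_ (E n)).
  apply/measurable_restrict => //; first exact: measurable_uball.
  by apply: measurable_funS mg => //; exact: measurable_uball.
exists E; split => //.
- move=> n; have [mF Fn] := Foo n.
  apply: (@le_lt_trans _ _ (\int[mu]_(z in D) (n%:R%:E * (\1_(F n) z)%:E))%E).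
    apply: ge0_le_integral_dom => z Dz; rewrite lee_fin ?gE//.
    rewrite patchE; case: ifPn => [|_]; last by rewrite mulr_ge0.
    by rewrite inE => -[Fz [_]] /=; rewrite in_itv/= indicE mem_set// mulr1.
  rewrite ge0_integralZl//=; [|exact: measurable_uball|].
    rewrite integral_indic//; last exact: measurable_uball.
    rewrite lte_mul_pinfty// ?lee_fin// (le_lt_trans _ Fn)// le_measure ?inE//.
      by apply: measurableI => //; exact: measurable_uball.
    exact: measurableT_comp.
- have -> : (\int[mu]_(z in D) (g z)%:E =
      \int[mu]_(z in D) limn (fun n => ((g \_ (E n)) z)%:E))%E.
    apply: eq_integral => z; rewrite inE => Dz; apply/esym/cvg_lim => //.
    apply: cvg_near_cst.
    have [m _ Fz] : (\bigcup_n F n) z by rewrite UF.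
    near=> n; congr EFin; rewrite patchE mem_set//; split.
      have mn : (m <= n)%N by near: n; exact: nbhs_infty_ge.
      by move/subsetPset : (ndF _ _ mn); exact.
    by split => //=; rewrite in_itv/=; near: n; exact: nbhs_infty_ger.
  apply: cvg_monotone_convergence.
  + exact: measurable_uball.
  + by move=> n; apply/measurable_EFinP.
  + by move=> n z Dz; rewrite lee_fin gE.
  + move=> z Dz m n mn; rewrite lee_fin !patchE; case: ifPn => [|_].
      rewrite inE => -[Fz [_ gz]]; rewrite mem_set//; split.
        by move/subsetPset : (ndF _ _ mn); exact.
      split => //; move: gz; rewrite /= !in_itv/= => /le_trans; apply.
      by rewrite ler_nat.
    by case: ifPn => // _; exact: g0.
Unshelve. all: by end_near. Qed.

Lemma bop_lower (p q Q s t C M : R) omega : 1 < p -> 0 <= C -> 0 <= M ->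
  measurable_fun D omega -> (forall z, 0 < omega z) ->
  (forall z w, D z -> D w -> cmod (bkernel (s + t) z w) <= C /\
                             2^-1 <= Re (bkernel (s + t) z w)) ->
  bop_bounded_by p q Q s t omega M ->
  (weight_constant p q Q s t omega <= ((2 * M) `^ p)%:E)%E.
Proof.
move=> p1 C0 M0 mw w0 KC bM.
have p0 : 0 < p by lra.
have p10 : 0 < p - 1 by lra.
have mpow r : measurable_fun D (fun z => omega z `^ r).
  exact: (measurableT_comp (measurable_powR r) mw).
rewrite /weight_constant/=; set c := q + _; set o := fun z => omega z `^ _.
set A := mu_integral (Q + p * t) omega; set B := mu_integral c o.
have A0 : (0 <= A)%E by apply: mu_integral_ge0 => z _; exact/ltW.
pose g z := o z * wt c z.
have mg : measurable_fun D g by exact: (measurable_real_integrand _ _ (mpow _)).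
have g0 z : 0 <= g z by rewrite mulr_ge0 ?powR_ge0 ?wt_ge0.
have [E [mE Efin Ecvg]] := integral_exhaustion g mg (fun z _ => g0 z).
pose b n := fine (\int[mu]_(z in D) ((g \_ (E n)) z)%:E)%E.
have gE0 n z : 0 <= (g \_ (E n)) z by rewrite patchE; case: ifPn.
have bE n : (\int[mu]_(z in D) ((g \_ (E n)) z)%:E = (b n)%:E)%E.
  rewrite fineK// ge0_fin_numE//; apply: integral_ge0 => z _.
  by rewrite lee_fin.
have b0 n : 0 <= b n by rewrite -lee_fin -bE; apply: integral_ge0 => z _; rewrite lee_fin.
(* The equality case of Hölder: both h wt_s and h^p omega wt_q equal [g]. After truncation the
   single number [b n] is thus the integral of [f n] against mu_s and the p-th power of its norm. *)
pose h z := o z * wt ((s - q) / (p - 1)) z.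
have h0 z : 0 <= h z by rewrite mulr_ge0 ?powR_ge0 ?wt_ge0.
have hE0 n z : 0 <= (h \_ (E n)) z by rewrite patchE; case: ifPn.
have mh n : measurable_fun D (h \_ (E n)).
  apply/measurable_restrict => //; first exact: measurable_uball.
  apply: (@measurable_funS _ _ _ _ D); first exact: measurable_uball.
    by move=> z [].
  exact: (measurable_real_integrand _ _ (mpow _)).
pose f n z := ((h \_ (E n)) z)%:C%C.
have mf n : measurable_fun D (f n).
  exact: (measurableT_comp measurable_real_complex (mh n)).
have hs n : mu_integral s (h \_ (E n)) = (b n)%:E.
  rewrite -bE; apply: eq_integral => z; rewrite inE => Dz; congr EFin.
  rewrite !patchE; case: ifPn => _; last by rewrite mul0r.
  rewrite /g /h -mulrA -wtD// /c; congr (_ * wt _ _).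
  by field; rewrite gt_eqF.
have fq n : mu_integral q (fun z => cmod (f n z) `^ p * omega z) = (b n)%:E.
  rewrite -bE; apply: eq_integral => z; rewrite inE => Dz; congr EFin.
  rewrite /f cmod_real ger0_norm// !patchE.
  case: ifPn => _; last by rewrite powR0 ?gt_eqF// !mul0r.
  rewrite /g /h powRM ?powR_ge0 ?wt_ge0// wt_powR /o -powRrM.
  rewrite -[X in _ * X * _](powRr1 (ltW (w0 z))).
  have -> (x y : R) : x * y * omega z `^ 1 * wt q z =
    (x * omega z `^ 1) * (wt q z * y) by ring.
  rewrite -powRD; last by apply/implyP => _; rewrite gt_eqF.
  rewrite -wtD// /c.
  have -> : - 1 / (p - 1) * p + 1 = - 1 / (p - 1) by field; rewrite gt_eqF.
  suff -> : q + (s - q) / (p - 1) * p = q + p / (p - 1) * (s - q) by [].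
  by ring.
have fnorm n : wnorm p q omega (f n) = ((b n) `^ p^-1)%:E.
  by rewrite /wnorm fq poweR_EFin.
have key n : (((2^-1 * b n) `^ p)%:E * A <= (M `^ p * b n)%:E)%E.
  have fin : in_wLp p q omega (f n) by split=> //; rewrite fnorm ltry.
  have := bM _ fin; rewrite fnorm -EFinM => hle.
  have k0 : 0 <= 2^-1 * b n by rewrite mulr_ge0.
  have hge : (mu_integral Q (fun z => ((wt t z * (2^-1 * b n)) `^ p * omega z)%R) `^ p^-1
      <= wnorm p Q omega (bop s t (f n)))%E.
    apply: lee_poweR; first by rewrite invr_ge0 ltW.
      by apply: mu_integral_ge0 => z _; rewrite mulr_ge0 ?powR_ge0// ltW.
    apply: ge0_le_integral_dom => z Dz.
      by rewrite lee_fin !mulr_ge0 ?powR_ge0 ?wt_ge0// ltW.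
    rewrite lee_fin ler_wpM2r ?wt_ge0// ler_wpM2r ?(ltW (w0 _))//.
    apply: ge0_ler_powR; rewrite ?nnegrE; [exact: ltW| |exact: cmod_ge0|].
      by rewrite mulr_ge0 ?wt_ge0.
    exact: (cmod_bop_ge s t C (h \_ (E n)) z Dz C0 (KC z ^~ Dz) (mf n)
      (fun w _ => hE0 n w) (mh n) (b n) (hs n)).
  have := le_trans hge hle.
  rewrite (mu_integral_wt_powR p Q t _ omega p0 k0 mw w0) => {}hle.
  have := lee_poweR p _ _ (ltW p0) (poweR_ge0 _ _) hle.
  rewrite -poweRrM mulVf ?gt_eqF// poweRe1; last by rewrite mule_ge0// lee_fin powR_ge0.
  by rewrite poweR_EFin (powRM _ M0 (powR_ge0 _ _)) -(powRrM (b n)) mulVf ?gt_eqF// powRr1.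
(* If [A] vanishes, or every [b n] does and hence [B], the product is 0 by the convention 0 * +oo =
   0. *)
have [->|A_neq0] := eqVneq A 0%E; first by rewrite mul0e lee_fin powR_ge0.
have A_gt0 : (0 < A)%E by rewrite lt_def A_neq0.
have [bpos|bnpos] := pselect (exists n, 0 < b n); last first.
  have B0 : B = 0%E.
    apply/eqP; rewrite eq_le mu_integral_ge0 ?andbT; last by move=> z _; exact: powR_ge0.
    apply: (cvge_to_le Ecvg); apply: nearW => n; rewrite bE lee_fin leNgt.
    by apply/negP => bn; apply: bnpos; exists n.
  by rewrite B0 poweR0r ?gt_eqF// mule0 lee_fin powR_ge0.
have [n0 bn0] := bpos.
(* An infinite [A] would make the left side of [key n0] infinite, as b n0 > 0. *)
have Afin : A = (fine A)%:E.
  rewrite fineK// ge0_fin_numE//; have := key n0.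
  case: (A) A_gt0 => [r _ _|_|//]; first exact: ltry.
  by rewrite gt0_muley// lte_fin powR_gt0// mulr_gt0.
set a := fine A in Afin.
have a0 : 0 < a by rewrite -lte_fin -Afin.
(* [L] solves a L^(p-1) = (2 M)^p, which is [key] after division by [b n]. *)
pose L := ((2 * M) `^ p / a) `^ (p - 1)^-1.
have bL n : b n <= L.
  have [->|bn] := eqVneq (b n) 0; first exact: powR_ge0.
  have bn' : 0 < b n by rewrite lt_def bn b0.
  rewrite -[leLHS]powRr1// -(mulfV (lt0r_neq0 p10)) powRrM.
  apply: ge0_ler_powR; rewrite ?nnegrE ?powR_ge0 ?divr_ge0 ?powR_ge0// ?(ltW a0)//.
    by rewrite invr_ge0 ltW.
  rewrite ler_pdivlMr//; have := key n; rewrite Afin -EFinM lee_fin.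
  rewrite !powRM// -(@mulr_powRB1 _ (b n) p)//.
  rewrite (_ : 2^-1 `^ p = (2 `^ p)^-1); last by rewrite -powR_inv1// powRAC -powR_inv1 ?powR_ge0.
  move=> hk; have p2 : 0 < 2 `^ p :> R by rewrite powR_gt0.
  rewrite -(ler_pM2l bn') -(ler_pM2l (x := (2 `^ p)^-1)) ?invr_gt0//.
  apply: (le_trans _ (le_trans hk _)); rewrite le_eqVlt; apply/orP; left; apply/eqP.
    by ring.
  by field; rewrite gt_eqF.
have BL : (B <= L%:E)%E.
  by apply: (cvge_to_le Ecvg); apply: nearW => n; rewrite bE lee_fin.
apply: (@le_trans _ _ (a%:E * (L%:E `^ (p - 1)))%E).
  rewrite Afin lee_wpmul2l ?lee_fin ?(ltW a0)//; apply: lee_poweR => //.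
    exact: ltW.
  by apply: mu_integral_ge0 => z _; exact: powR_ge0.
rewrite poweR_EFin -EFinM lee_fin /L -powRrM mulVf ?gt_eqF// powRr1; last first.
  by rewrite divr_ge0 ?powR_ge0// ltW.
by rewrite mulrC divfK// gt_eqF.
Qed.

End lower.

(** * Almost everywhere equal weights and degenerate products *)

Section weights.
Context {R : realType} {N : nat}.
Local Notation CN := (N.-tuple R[i]).
Local Notation mu := (@ball_measure R N).
Local Notation D := (@uball R N).
Implicit Types (z w : CN) (f : CN -> R[i]) (omega : CN -> R).

Lemma ae_eq_mu_integral (c : R) (g h : CN -> R) :
  {ae mu, forall z, D z -> g z = h z} -> mu_integral c g = mu_integral c h.
Proof.
move=> gh; apply: ae_eq_integral_dom.
by apply: filterS gh => z gh Dz; rewrite gh.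
Qed.

Lemma wnorm_ae (p c : R) omega omega' :
  {ae mu, forall z, D z -> omega z = omega' z} ->
  wnorm p c omega = wnorm p c omega'.
Proof.
move=> e; apply/funext => f; rewrite /wnorm; congr (_ `^ _)%E.
by apply: ae_eq_mu_integral; apply: filterS e => z e Dz; rewrite e.
Qed.

Lemma weight_constant_ae (p q Q s t : R) omega omega' :
  {ae mu, forall z, D z -> omega z = omega' z} ->
  weight_constant p q Q s t omega = weight_constant p q Q s t omega'.
Proof.
move=> e; rewrite /weight_constant/=; congr (_ * _ `^ _)%E;
  apply: ae_eq_mu_integral => //.
by apply: filterS e => z e Dz; rewrite e.
Qed.

(* A weight is positive only almost everywhere on the ball, and arbitrary
   elsewhere; the operator norm only sees its a.e. class. *)
Lemma weight_positive omega : is_weight omega -> exists omega' : CN -> R,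
  [/\ measurable_fun D omega', forall z, 0 < omega' z &
      {ae mu, forall z, D z -> omega z = omega' z}].
Proof.
move=> [mw w0 _]; exists (fun z => if 0 < omega z then omega z else 1); split.
- apply: measurable_fun_if => //; first exact: measurable_uball.
    by apply: measurable_fun_ltr.
  by apply: measurable_funS mw => //; exact: measurable_uball.
- by move=> z; case: ifPn.
- by apply: filterS w0 => z w0 Dz; rewrite w0.
Qed.

(** A positive function with zero integral forces the ball to be null, and then every integral over
    it is 0. This settles the products 0 * +oo without computing the measure of the ball. *)
Lemma mu_integral_eq0 (c c' : R) (g h : CN -> R) :
  measurable_fun D g -> (forall z, 0 < g z) -> mu_integral c g = 0%E ->
  mu_integral c' h = 0%E.
Proof.
move=> mg g0 gc; rewrite -[RHS](integral0 mu D); apply: ae_eq_integral_dom.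
have := ae_eq_integral_abs mu measurable_uball
  (f := fun z => (g z * wt c z)%:E) _.
have mgc : measurable_fun D (fun z => (g z * wt c z)%:E).
  by apply/measurable_EFinP; exact: measurable_real_integrand.
move=> /(_ mgc)[+ _].
have -> : (\int[mu]_(z in D) `|(g z * wt c z)%:E| = 0)%E.
  rewrite -gc; apply: eq_integral => z; rewrite inE => Dz.
  by rewrite /= ger0_norm// mulr_ge0 ?wt_ge0 ?ltW.
move=> /(_ erefl); apply: filterS => z gz Dz; move: (gz Dz) => -[] /eqP.
by rewrite gt_eqF// mulr_gt0 ?wt_gt0.
Qed.

(** As 0 * +oo = 0, finiteness of a product does not by itself give finite factors; here a zero
    factor forces the other to be zero as well. *)
Lemma weight_constant_fin (p q Q s t : R) omega : 1 < p ->
  measurable_fun D omega -> (forall z, 0 < omega z) ->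
  (weight_constant p q Q s t omega < +oo)%E ->
  exists a b : R, [/\ mu_integral (Q + p * t) omega = a%:E,
    mu_integral (q + p / (p - 1) * (s - q))
      (fun z => (omega z `^ (- 1 / (p - 1)))%R) = b%:E &
    weight_constant p q Q s t omega = (a * b `^ (p - 1))%:E].
Proof.
move=> p1 mw w0; rewrite /weight_constant/=.
have p10 : 0 < p - 1 by lra.
set c := Q + _; set c' := q + _; set o := fun z => omega z `^ _.
have mo : measurable_fun D o by exact: (measurableT_comp (measurable_powR _) mw).
have o0 z : 0 < o z by rewrite powR_gt0.
have AB := mu_integral_eq0 c c' _ o mw w0.
have BA := mu_integral_eq0 c' c _ omega mo o0.
have A0 : (0 <= mu_integral c omega)%E by apply: mu_integral_ge0 => z _; exact: ltW.
have B0 : (0 <= mu_integral c' o)%E by apply: mu_integral_ge0 => z _; exact: ltW.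
have [A1|A1] := eqVneq (mu_integral c omega) 0%E.
  by move=> _; exists 0, 0; rewrite A1 AB// mul0e mul0r.
have B1 : (mu_integral c' o != 0)%E by apply: contra_neq A1.
move: A0 B0 A1 B1 {AB BA}.
case: (mu_integral c omega) => [a||]//; case: (mu_integral c' o) => [b||]// A0 B0 A1 B1.
- by move=> _; exists a, b; rewrite poweR_EFin -EFinM.
- rewrite poweRyr ?gt_eqF// gt0_muley ?ltxx//.
  by rewrite lt_def A1.
- by rewrite gt0_mulye ?ltxx// poweR_gt0// lt_def B1.
- by rewrite poweRyr ?gt_eqF// mulyy ltxx.
Qed.

End weights.

(** * From positive weights to all weights, and from bounds to the norm *)

Theorem theorem1p7 (R : realType) (N : nat) (p q Q s t : R) :
  (0 < N)%N -> 1 < p -> -1 < s -> s + t < - (N%:R + 1) -> q < Q ->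
  (forall omega : N.-tuple R[i] -> R, is_weight omega ->
     (bop_well_defined_continuous p q Q s t omega <->
      (weight_constant p q Q s t omega < +oo)%E)) /\
  (exists c1 c2 : R, [/\ 0 < c1, 0 < c2 &
     forall omega : N.-tuple R[i] -> R, is_weight omega ->
       (c1%:E * weight_constant p q Q s t omega
          <= bop_norm p q Q s t omega `^ p
          <= c2%:E * weight_constant p q Q s t omega)%E]).
Proof.
move=> _ p1 _ stN _; have p0 : 0 < p by lra.
have [C C0 KC] := @bkernel_bounds R N _ stN.
have KC1 (z w : N.-tuple R[i]) : uball z -> uball w -> cmod (bkernel (s + t) z w) <= C.
  by move=> zD wD; case: (KC z w zD wD).
have upper (omega : N.-tuple R[i] -> R) : is_weight omega ->
    (weight_constant p q Q s t omega < +oo)%E -> exists M : R,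
    [/\ 0 <= M, bop_well_defined p q s t omega, bop_bounded_by p q Q s t omega M &
        (M `^ p)%:E = (((2 * C) `^ p)%:E * weight_constant p q Q s t omega)%E].
  move=> /weight_positive[w [mw w0 we]].
  (* These notions see omega only through [wnorm], so it can be exchanged for its positive version
     by rewriting. *)
  rewrite /bop_well_defined /bop_bounded_by /in_wLp !(wnorm_ae _ _ _ _ we).
  rewrite (weight_constant_ae _ _ _ _ _ _ _ we).
  move=> /(weight_constant_fin p q Q s t w p1 mw w0)[a [b [Aa Bb ->]]].
  have a0 : 0 <= a by rewrite -lee_fin -Aa mu_integral_ge0// => z _; exact/ltW.
  have [wd bd] := bop_upper p q Q s t C a b w p1 (ltW C0) mw w0 KC1 Aa Bb.
  exists (2 * C * (a * b `^ (p - 1)) `^ p^-1); split => //.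
    by rewrite !mulr_ge0 ?powR_ge0// ltW.
  rewrite -EFinM powRM ?powR_ge0 ?mulr_ge0 ?(ltW C0)//.
  by rewrite -powRrM mulVf ?gt_eqF// powRr1// mulr_ge0 ?powR_ge0.
have lower (omega : N.-tuple R[i] -> R) M : is_weight omega -> 0 <= M ->
    bop_bounded_by p q Q s t omega M ->
    (weight_constant p q Q s t omega <= ((2 * M) `^ p)%:E)%E.
  move=> /weight_positive[w [mw w0 we]] M0.
  rewrite /bop_bounded_by /in_wLp !(wnorm_ae _ _ _ _ we).
  rewrite (weight_constant_ae _ _ _ _ _ _ _ we) => bM.
  exact: (bop_lower p q Q s t C M w p1 (ltW C0) M0 mw w0 KC).
split=> [omega ww|].
  split=> [[_ [M bM]]|/(upper omega ww)[M [M0 wd bd _]]]; last by split=> //; exists M.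
  (* Continuity supplies a bound M of unknown sign, while [lower] wants a nonnegative one. *)
  apply: (le_lt_trans (lower omega `|M| ww (normr_ge0 _) _)); last exact: ltry.
  move=> f fin; apply: (le_trans (bM f fin)).
  by rewrite lee_wpmul2r ?wnorm_ge0// lee_fin ler_norm.
exists (2^-1 `^ p), ((2 * C) `^ p); split; rewrite ?powR_gt0 ?mulr_gt0//.
move=> omega ww; set W := weight_constant _ _ _ _ _ _.
have W0 : (0 <= W)%E.
  have [w [mw w0 we]] := weight_positive omega ww.
  rewrite /W (weight_constant_ae _ _ _ _ _ _ _ we) mule_ge0 ?poweR_ge0//.
  by apply: mu_integral_ge0 => z _; exact/ltW.
have norm0 : (0 <= bop_norm p q Q s t omega)%E.
  by apply: le_ereal_inf_tmp => _ [M [M0 _ _] <-]; rewrite lee_fin.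
apply/andP; split.
  (* [lower] gives W^(1/p) <= 2 M for each admissible M, which passes to the infimum, including the
     value +oo of an empty set. *)
  have : ((2^-1)%:E * W `^ p^-1 <= bop_norm p q Q s t omega)%E.
    apply: le_ereal_inf_tmp => _ [M [M0 _ bM] <-].
    have := lee_poweR p^-1 _ _ _ W0 (lower omega M ww M0 bM).
    rewrite invr_ge0 (ltW p0) => /(_ isT).
    rewrite poweR_EFin -powRrM mulfV ?gt_eqF// powRr1 ?mulr_ge0//.
    move=> h; apply: (@le_trans _ _ ((2^-1)%:E * (2 * M)%:E)%E).
      by rewrite lee_wpmul2l// lee_fin.
    by rewrite -EFinM lee_fin mulKf.
  move=> /(lee_poweR p _ _ (ltW p0)); rewrite mule_ge0 ?poweR_ge0// ?lee_fin//.
  move=> /(_ isT); rewrite poweRM ?poweR_ge0// ?lee_fin//.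
  by rewrite -poweRrM mulVf ?gt_eqF// poweRe1.
have [Wy|Wfin] := eqVneq W +oo%E.
  by rewrite Wy gt0_muley ?leey// lte_fin powR_gt0 ?mulr_gt0.
have [|M [M0 wd bd <-]] := upper omega ww; first by rewrite ltey.
rewrite -poweR_EFin; apply: lee_poweR => //; first exact: ltW.
by apply: ereal_inf_lbound; exists M.
Qed.
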